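(* Let $T$ be a tree of type $H$ with parameters $(s,t;r;a,b)$. Then $T$ is a path-like tree with a bridge path if and only if one of the following holds: (i) there exist a divisor $d_1$ of $s$, a divisor $d_2$ of $t$ and an integer $\delta$ with $2\le\delta\le\min\{d_1,d_2\}-1$ such that $d_1-\delta=\min\{a-1,s-a\}$, $d_2-\delta=\min\{b-1,t-b\}$ and $\delta$ divides $r-1$; (ii) there exists $\delta\in\{a,s-a+1\}\cap\{b,t-b+1\}$ such that $\delta$ divides $r-1$; (iii) there exist $\delta\in\{a,s-a+1\}$ and a divisor $d_2$ of $t$ such that $d_2-\delta=\min\{b-1,t-b\}$ and $\delta$ divides $r-1$; (iv) there exist $\delta\in\{b,t-b+1\}$ and a divisor $d_1$ of $s$ such that $d_1-\delta=\min\{a-1,s-a\}$ and $\delta$ divides $r-1$.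
   Context: A tree of type $H$ with parameters $(s,t;r;a,b)$, where $r\ge1$, $1<a<s$, $1<b<t$, is the tree with vertex set $\{u_1,\ldots,u_s,v_1,\ldots,v_t,w_1,\ldots,w_{r+1}\}$ in which $u_a=w_1$, $v_b=w_{r+1}$, and edge set $\{u_1u_2,\ldots,u_{s-1}u_s\}\cup\{v_1v_2,\ldots,v_{t-1}v_t\}\cup\{w_1w_2,\ldots,w_rw_{r+1}\}$. Its only vertices of degree $3$ are $u_a$ and $v_b$. A linear configuration of a tree $T$ consists of paths $P^1_{k_1},\ldots,P^n_{k_n}$, $P^i_{k_i}=v^i_1v^i_2\cdots v^i_{k_i}$, whose vertex sets partition $V(T)$, whose edges are edges of $T$, and such that every other edge of $T$ is of the form $v^l_iv^{l+1}_j$ ($1\le l\le n-1$) with $d_T(v^l_i,v^l_{k_l})=d_T(v^{l+1}_1,v^{l+1}_j)$ and $j>1$ ($d_T$ = distance in $T$). A tree is a path-like tree if and only if it admits a linear configuration. $T$ (of type $H$) is a path-like tree with a bridge path if it admits a linear configuration in which the two vertices of degree $3$ are $\omega_1\in P^l_{k_l}$ and $\omega_2\in P^{l+m}_{k_{l+m}}$ for some $m\ge1$, where $\omega_1$ is adjacent to a vertex of $P^{l+1}_{k_{l+1}}$ and $\omega_2$ is adjacent to a vertex of $P^{l+m-1}_{k_{l+m-1}}$. *)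

(* Defs.v *)
From mathcomp Require Import all_boot.
Set Implicit Arguments.
Unset Strict Implicit.
Unset Printing Implicit Defensive.

(* Graphs are given by their adjacency relation on a finite vertex type. *)

(* x and y are consecutive, in one order or the other, in the sequence p. *)
Definition path_edge (T : eqType) (p : seq T) (x y : T) : bool :=
  ((x, y) \in zip p (behead p)) || ((y, x) \in zip p (behead p)).

Definition is_type_H (T : finType) (e : rel T) (s t r a b : nat) : Prop :=
  exists u v w : nat -> T,
    let us := [seq u i | i <- iota 1 s] in
    let vs := [seq v i | i <- iota 1 t] in
    let ws := [seq w i | i <- iota 1 r.+1] in
    [/\ u a = w 1,
        v b = w r.+1,
        (* apart from the two identifications above, the u_i, v_i, w_i are
           pairwise distinct, and they exhaust the vertex set *)
        perm_eq (us ++ vs ++ [seq w i | i <- iota 2 r.-1]) (enum T)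
      & forall x y : T,
          e x y = [|| path_edge us x y, path_edge vs x y | path_edge ws x y]].

Definition degree (T : finType) (e : rel T) (x : T) : nat := #|[set y | e x y]|.

(* Length of a shortest walk from x to y; the value is #|T| if there is none. *)
Definition dist (T : finType) (e : rel T) (x y : T) : nat :=
  find (fun n => [exists p : n.-tuple T, path e x p && (last x p == y)])
       (iota 0 #|T|).

(* Positions are counted from 0, so j > 1 for the vertex v_j reads 0 < j. *)
Definition link_edge (T : finType) (e : rel T) (P Q : seq T) (x y : T) : Prop :=
  exists i j : nat,
    [/\ i < size P, 0 < j < size Q, x = nth x P i, y = nth y Q j
      & dist e x (last x P) = dist e (head y Q) y].

Definition linear_configuration (T : finType) (e : rel T) (C : seq (seq T)) :
    Prop :=
  [/\ [::] \notin C,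
      perm_eq (flatten C) (enum T),
      (forall P : seq T, P \in C -> sorted e P)
    & forall x y : T, e x y -> ~~ has (fun P => path_edge P x y) C ->
        exists2 l : nat, l.+1 < size C &
          link_edge e (nth [::] C l) (nth [::] C l.+1) x y \/
          link_edge e (nth [::] C l) (nth [::] C l.+1) y x].

Definition path_like_with_bridge_path (T : finType) (e : rel T) : Prop :=
  exists (C : seq (seq T)) (l m : nat) (w1 w2 : T),
    linear_configuration e C /\
    [/\ 1 <= m /\ l + m < size C,
        w1 != w2 /\ [set x | degree e x == 3] = [set w1; w2],
        w1 \in nth [::] C l /\ w2 \in nth [::] C (l + m),
        (exists2 x, x \in nth [::] C (l + 1) & e w1 x)
      & (exists2 y, y \in nth [::] C (l + m - 1) & e w2 y)].

(* Main.v *)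
Require Import Defs.
From mathcomp Require Import all_boot ssrint.
From mathcomp Require Import zify.

Set Implicit Arguments.
Unset Strict Implicit.
Unset Printing Implicit Defensive.

(** In a linear configuration of a tree, consecutive rows are joined by exactly
    one edge, joining two vertices at the same distance [d] from an end of one
    row and from an end of the next. Writing the rows one after the other turns
    the tree into a chain of paths, and a link with [d + 1] equal to both row
    lengths then joins consecutive vertices. Any other link creates a vertex of
    degree 3, so with only two such vertices, at the two ends of the bridge, the
    rows before, inside and after the bridge have constant lengths [k1],
    [delta] and [k2], and the chain displays a tree of type H with
    [s = q1 k1], [r - 1 = m delta], [t = q2 k2] whose branch vertices are at
    distance [k1 - delta] and [k2 - delta] from an end of their arms. The
    parameters of a tree of type H are determined up to symmetry by the
    distances from its branch vertices; conversely, arms and a bridge of these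
    lengths can be cut into rows. The four cases of the theorem list whether
    [k1 = s] and whether [k2 = t]. *)

(** * Edges of a path *)

Lemma path_edge_sym (T : eqType) (p : seq T) : symmetric (path_edge p).
Proof. by move=> x y; rewrite /path_edge orbC. Qed.

Lemma path_edgeP (T : eqType) (x0 : T) (p : seq T) (x y : T) :
  reflect (exists2 k, k.+1 < size p &
             x = nth x0 p k /\ y = nth x0 p k.+1 \/
             y = nth x0 p k /\ x = nth x0 p k.+1)
          (path_edge p x y).
Proof.
have zipP u v : reflect
    (exists2 k, k.+1 < size p & u = nth x0 p k /\ v = nth x0 p k.+1)
    ((u, v) \in zip p (behead p)).
  have sizeE : size (zip p (behead p)) = (size p).-1.
    by rewrite size_zip size_behead; lia.
  apply: (iffP (nthP (x0, x0))) => [] [k].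
    rewrite sizeE nth_zip_cond sizeE nth_behead => k_lt; rewrite k_lt.
    by case=> <- <-; exists k => //; lia.
  move=> k_lt [-> ->]; have k_lt' : k < (size p).-1 by lia.
  by exists k; rewrite ?nth_zip_cond sizeE // k_lt' nth_behead.
apply: (iffP orP) => [[/zipP|/zipP]|[k k_lt [kE|kE]]].
- by case=> k k_lt kE; exists k => //; left.
- by case=> k k_lt kE; exists k => //; right.
- by left; apply/zipP; exists k.
- by right; apply/zipP; exists k.
Qed.

Lemma path_edge_map (T T' : eqType) (f : T -> T') (p : seq T) x y :
  injective f -> path_edge (map f p) (f x) (f y) = path_edge p x y.
Proof.
move=> f_inj; apply/(path_edgeP (f x))/(path_edgeP x) => [] [k];
  rewrite ?size_map => k_lt kE; exists k; rewrite ?size_map //.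
  move: kE; rewrite !(nth_map x) //; last exact: ltnW.
  by case=> [] [/f_inj ? /f_inj ?]; [left|right].
rewrite !(nth_map x) //; last exact: ltnW.
by case: kE => [] [<- <-]; [left|right].
Qed.

Lemma path_edge_rev (T : eqType) (p : seq T) : path_edge (rev p) =2 path_edge p.
Proof.
have path_edge_revW q x y : path_edge q x y -> path_edge (rev q) x y.
  move/(path_edgeP x) => [k k_lt kE]; apply/(path_edgeP x).
  exists (size q - k.+2); rewrite ?size_rev; first lia.
  rewrite !nth_rev; try lia.
  have -> : size q - (size q - k.+2).+1 = k.+1 by lia.
  have -> : size q - (size q - k.+2).+2 = k by lia.
  by case: kE => [] []; [right | left].
by move=> x y; apply/idP/idP => /path_edge_revW //; rewrite revK.
Qed.

Lemma path_edge_mkseqP (T : eqType) (f : nat -> T) n x y :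
  reflect (exists2 k, k.+1 < n &
             x = f k /\ y = f k.+1 \/ y = f k /\ x = f k.+1)
          (path_edge (mkseq f n) x y).
Proof.
apply: (iffP (@path_edgeP _ x (mkseq f n) x y)) => [] [k];
  rewrite ?size_mkseq => k_lt kE; exists k; rewrite ?size_mkseq //.
  by move: kE; rewrite !nth_mkseq //; apply: ltnW.
by rewrite !nth_mkseq //; apply: ltnW.
Qed.

Lemma path_edge_iota m n p q :
  path_edge (iota m n) p q =
  [&& m <= p < m + n, m <= q < m + n & (p.+1 == q) || (q.+1 == p)].
Proof.
rewrite -[m]addn0 iotaDl; apply/path_edge_mkseqP/idP => [[k kn]|pq].
  by lia.
by exists (minn p q - m); lia.
Qed.

(** * Distances in trees *)

Lemma sorted_segment (T : eqType) (e : rel T) (x0 : T) (p : seq T) i j :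
  sorted e p -> uniq p -> i <= j < size p ->
  exists q, [/\ path e (nth x0 p i) q, last (nth x0 p i) q = nth x0 p j,
    uniq (nth x0 p i :: q), size q = j - i
  & {subset nth x0 p i :: q <= p}].
Proof.
move=> ep up /andP[ij jp]; have ip : i < size p := leq_ltn_trans ij jp.
set q := take (j - i) (drop i.+1 p).
have consE : nth x0 p i :: q = take (j - i).+1 (drop i p).
  by rewrite (drop_nth x0 ip).
have size_q : size q = j - i by rewrite size_takel // size_drop; lia.
exists q; rewrite consE; split=> //.
- by have := take_sorted (j - i).+1 (drop_sorted i ep); rewrite -consE.
- by rewrite (last_nth x0) size_q consE nth_take // nth_drop subnKC.
- exact/take_uniq/drop_uniq.
- by move=> x /mem_take/mem_drop.
Qed.

Lemma dist_shortest (T : finType) (e : rel T) x p :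
  path e x p -> size p < #|T| ->
  (forall q, path e x q -> last x q = last x p -> size p <= size q) ->
  dist e x (last x p) = size p.
Proof.
move=> ep p_lt p_min; rewrite /dist; set walk := (X in find X _).
have walk_p : walk (size p).
  by apply/existsP; exists (in_tuple p); rewrite /= ep eqxx.
have walk_min n : walk n -> size p <= n.
  by case/existsP=> q /andP[eq /eqP/(p_min _ eq)]; rewrite size_tuple.
have has_walk : has walk (iota 0 #|T|).
  by apply/hasP; exists (size p); rewrite ?mem_iota.
apply/eqP; rewrite eqn_leq; apply/andP; split.
  rewrite leqNgt; apply/negP=> /(before_find 0).
  by rewrite nth_iota // walk_p.
have := nth_find 0 has_walk; move: has_walk; rewrite has_find size_iota => ?.
by rewrite nth_iota // => /walk_min.
Qed.

Lemma dist_unique (T : finType) (e : rel T) (D : T -> T -> nat) (y x : T) :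
  (forall z, D y z = 0 -> z = y) -> D y y = 0 ->
  (forall x z, e x z -> D y z <= (D y x).+1) ->
  (forall x, x != y -> exists2 z, e z x & D y x = (D y z).+1) ->
  dist e y x = D y x.
Proof.
move=> D0 Dyy De closer.
have lower c z : path e z c -> D y (last z c) <= D y z + size c.
  elim: c z => [|z' c IHc] z /=; first by rewrite addn0.
  by case/andP=> /De ? /IHc; lia.
have [c [ec cx Dc]] : exists c,
    [/\ path e y c, last y c = x & map (D y) c = iota 1 (D y x)].
  move: {2}(D y x) (erefl (D y x)) => n; elim: n x => [|n IHn] x Dx.
    by exists [::]; rewrite Dx /= (D0 x).
  have [|z ezx Dz] := closer x.
    by apply: contra_eq_neq Dx => ->; rewrite Dyy.
  have [|c [ec cz Dc]] := IHn z; first by lia.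
  exists (rcons c x); rewrite rcons_path last_rcons ec cz ezx; split=> //.
  by rewrite map_rcons Dc Dz -[in RHS](addn1 (D y z)) iotaD cats1.
have size_c : size c = D y x by rewrite -(size_map (D y)) Dc size_iota.
have uniq_c : uniq (y :: c).
  by apply: (@map_uniq _ _ (D y)); rewrite map_cons Dyy Dc (iota_uniq 0 _.+1).
rewrite -[in LHS]cx -size_c; apply: dist_shortest => // [|q /lower + qx].
  by rewrite -[_.+1]/(size (y :: c)) -(card_uniqP uniq_c) max_card.
by rewrite qx cx Dyy size_c.
Qed.

(* Such a function exists on a connected graph exactly when the graph is a tree,
   and it is then the distance. *)
Record tree_metric (T : finType) (e : rel T) (D : T -> T -> nat) : Prop :=
  TreeMetric {
    tree_sym : symmetric e;
    tree_eq0 : forall y x, (D y x == 0) = (x == y);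
    tree_step : forall y x z, e x z -> D y z = (D y x).+1 \/ D y x = (D y z).+1;
    tree_closer_uniq : forall y x z z', e x z -> e x z' ->
      D y x = (D y z).+1 -> D y x = (D y z').+1 -> z = z';
    tree_closer : forall y x, x != y -> exists2 z, e x z & D y x = (D y z).+1
  }.

Section TreeMetric.
Variables (T : finType) (e : rel T) (D : T -> T -> nat).
Hypothesis tree : tree_metric e D.

Lemma tree_metric_dist y x : dist e y x = D y x.
Proof.
apply: dist_unique.
- by move=> z /eqP; rewrite (tree_eq0 tree) => /eqP.
- by apply/eqP; rewrite (tree_eq0 tree).
- by move=> z z' /(tree_step tree y); lia.
- move=> z /(tree_closer tree)[z' ezz' Dz].
  by exists z'; rewrite ?(tree_sym tree z').
Qed.

(* Each vertex has only one neighbour closer to y, so that a walk which moves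
   away from y goes on doing so until it turns back. *)
Lemma tree_moving_away y x z p :
  path e x (z :: p) -> uniq (x :: z :: p) -> D y z = (D y x).+1 ->
  D y (last z p) = D y z + size p.
Proof.
elim: p x z => [|w p IHp] x z; first by rewrite addn0.
case/and3P=> exz ezw ep /andP[x_notin u] Dz.
rewrite /= addnS -addSn; case: (tree_step tree y ezw) => Dw.
  by rewrite -Dw; apply: (IHp z w) => //; rewrite /= ezw.
suff xw : x = w by rewrite xw !inE eqxx orbT in x_notin.
by move: exz; rewrite (tree_sym tree) => /(tree_closer_uniq tree)/(_ ezw Dz Dw).
Qed.

Lemma tree_simple_path_dist x p :
  path e x p -> uniq (x :: p) -> dist e x (last x p) = size p.
Proof.
have Dxx : D x x = 0 by apply/eqP; rewrite (tree_eq0 tree).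
rewrite tree_metric_dist; case: p => [|z p] // ep u.
have Dxz : D x z = 1.
  by case/andP: ep => /(tree_step tree x)[]; rewrite Dxx.
by rewrite (tree_moving_away ep u) ?Dxx ?Dxz.
Qed.

Lemma tree_simple_path_chord x p :
  path e x p -> uniq (x :: p) -> 1 < size p -> ~~ e x (last x p).
Proof.
move=> ep u p_gt1; apply: contraTN p_gt1 => /(tree_step tree x).
have Dxx : D x x = 0 by apply/eqP; rewrite (tree_eq0 tree).
by rewrite -tree_metric_dist tree_simple_path_dist // Dxx => -[->|].
Qed.

Lemma tree_dist_in_path x0 p i j :
  sorted e p -> uniq p -> i <= j < size p ->
  dist e (nth x0 p i) (nth x0 p j) = j - i.
Proof.
move=> ep up /(sorted_segment x0 ep up)[q [eq <- uq <- _]].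
exact: tree_simple_path_dist.
Qed.

Lemma tree_connected (S : pred T) y :
  S y -> (forall x z, S x -> e x z -> S z) -> forall x, S x.
Proof.
move=> Sy S_closed x; have [n] := ubnP (D y x).
elim: n x => // n IHn x Dx; have [->//|] := eqVneq x y.
case/(tree_closer tree)=> z exz Dz.
by apply: (S_closed z); [apply: IHn; lia | rewrite (tree_sym tree)].
Qed.
End TreeMetric.

(** * Chains of paths *)

Section Chain.
Variables (N : nat) (row up low : nat -> nat).

Definition chain_step : rel nat := fun p q =>
  (p.+1 == q) && (row p == row q) ||
  [&& (row p).+1 == row q, p == up (row p) & q == low (row q)].

Definition chain_adj : rel nat := fun p q => chain_step p q || chain_step q p.

Lemma chain_adj_next p q :
  (row p).+1 = row q -> chain_adj p q -> p = up (row p) /\ q = low (row q).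
Proof.
by move=> rowE /orP[]/orP[/andP[_ /eqP]|/and3P[/eqP + /eqP + /eqP]]; lia.
Qed.

(* Positions below N fall into consecutive rows; each row is a path, and a
   single edge leads from row l, at its position up l, to position low l.+1. *)
Record chain_layout : Prop := ChainLayout {
  row_first : row 0 = 0;
  row_succ : forall p, p.+1 < N -> row p <= row p.+1 <= (row p).+1;
  row_up : forall l, l < row N.-1 -> up l < N /\ row (up l) = l;
  row_low : forall l, 0 < l <= row N.-1 -> low l < N /\ row (low l) = l
}.

Hypothesis layout : chain_layout.

Lemma chain_row_mono p q : p <= q < N -> row p <= row q.
Proof.
elim: q => [|q IHq] /andP[pq qN]; first by have -> : p = 0 by lia.
have [->//|pq'] := eqVneq p q.+1.
by have := IHq; have := row_succ layout qN; lia.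
Qed.

Lemma chain_row_max p : p < N -> row p <= row N.-1.
Proof. by move=> pN; apply: chain_row_mono; lia. Qed.

Definition chain_neighbours p : seq nat :=
  nseq ((0 < p) && (row p.-1 == row p)) p.-1 ++
  nseq ((p.+1 < N) && (row p.+1 == row p)) p.+1 ++
  nseq ((row p < row N.-1) && (p == up (row p))) (low (row p).+1) ++
  nseq ((0 < row p) && (p == low (row p))) (up (row p).-1).

Lemma mem_chain_neighbours p q : p < N ->
  (q \in chain_neighbours p) = (q < N) && chain_adj p q.
Proof.
move=> pN; have rowp := chain_row_max pN.
rewrite !mem_cat !mem_nseq !lt0b /chain_adj /chain_step; apply/idP/idP.
  case/or4P=> /andP[+ /eqP ->]; try lia.
    case/andP=> rowp_lt pE.
    by have [|qN ->] := row_low layout (l := (row p).+1); lia.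
  case/andP=> rowp_gt0 pE.
  by have [|qN ->] := row_up layout (l := (row p).-1); lia.
case/andP=> qN; have := chain_row_max qN => rowq.
case/orP=> /orP[/andP[/eqP qE rowE]|/and3P[/eqP rowE /eqP pE /eqP qE]].
- by move: rowE; rewrite -qE => rowE; lia.
- by rewrite rowE -pE -qE; lia.
- by move: rowE; rewrite -qE /= => rowE; lia.
- by rewrite -rowE /= -pE rowE -qE; lia.
Qed.

Lemma uniq_chain_neighbours p : p < N -> uniq (chain_neighbours p).
Proof.
move=> pN; have rowp := chain_row_max pN.
have row_below : row p < row N.-1 -> row (low (row p).+1) = (row p).+1.
  by move=> ?; apply: (row_low layout _).2; lia.
have row_above : 0 < row p -> row (up (row p).-1) = (row p).-1.
  by move=> ?; apply: (row_up layout _).2; lia.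
pose key q := (row q).*2 + (p < q); apply: (@map_uniq _ _ key).
rewrite !map_cat !map_nseq /key.
case: andP => [[? /eqP ->]|_]; case: andP => [[_ /eqP ->]|_];
case: andP => [[/row_below -> _]|_];
case: andP => [[/[dup] ? /row_above -> _]|_]; rewrite //= ?inE; lia.
Qed.

Lemma count_chain_adj p : p < N ->
  count (chain_adj p) (iota 0 N) =
  ((0 < p) && (row p.-1 == row p)) + ((p.+1 < N) && (row p.+1 == row p)) +
  ((row p < row N.-1) && (p == up (row p))) +
  ((0 < row p) && (p == low (row p))).
Proof.
move=> pN; transitivity (size (chain_neighbours p)); last first.
  by rewrite !size_cat !size_nseq !addnA.
rewrite -size_filter; apply/perm_size/uniq_perm => [||q].
- exact/filter_uniq/iota_uniq.
- exact: uniq_chain_neighbours.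
- by rewrite mem_filter mem_iota mem_chain_neighbours // andbC.
Qed.

(* Exactly one edge joins a position below c to a position at or above c. *)
Definition cut_lo c := if row c.-1 == row c then c.-1 else up (row c.-1).
Definition cut_hi c := if row c.-1 == row c then c else low (row c).

Lemma chain_row_start l : 0 < l <= row N.-1 ->
  exists2 c, 0 < c < N & row c.-1 = l.-1 /\ row c = l.
Proof.
case/andP=> l_gt0 l_max; have ex_c : exists c, l <= row c by exists N.-1.
case: (ex_minnP ex_c) => -[|c] l_c c_min.
  by move: l_c; rewrite (row_first layout); lia.
have cN := c_min _ l_max.
have row_c : row c < l by rewrite ltnNge; apply/negP=> /c_min; rewrite ltnn.
exists c.+1; first lia.
by have := row_succ layout (p := c); rewrite /=; lia.
Qed.

Lemma chain_step_cutP p q : p < N -> q < N ->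
  reflect (exists2 c, 0 < c < N & p = cut_lo c /\ q = cut_hi c)
          (chain_step p q).
Proof.
move=> pN qN; rewrite /cut_lo /cut_hi; apply: (iffP orP) => [[]|[c cN [-> ->]]].
- case/andP=> /eqP qE rowE; exists q; first lia.
  by rewrite -qE /= qE rowE -qE.
- case/and3P=> /eqP rowE /eqP pE /eqP qE.
  have [|c cN [row_c1 row_c]] := @chain_row_start (row q).
    by have := chain_row_max qN; lia.
  exists c => //; rewrite row_c1 row_c; case: eqP => [|_]; first lia.
  by split=> //; rewrite -rowE.
case: (row c.-1 =P row c) => row_c; [left; lia | right].
have row_cS : row c = (row c.-1).+1.
  by have := row_succ layout (p := c.-1); rewrite prednK; lia.
have c_max : row c <= row N.-1 by apply: chain_row_max; lia.
have [|_ ->] := row_up layout (l := row c.-1); first lia.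
have [|_ ->] := row_low layout (l := row c); first lia.
by rewrite row_cS !eqxx.
Qed.
End Chain.

Lemma eq_chain_adj N row up low row' up' low' :
  chain_layout N row up low -> chain_layout N row' up' low' ->
  (forall c, 0 < c < N -> cut_lo row up c = cut_lo row' up' c /\
                          cut_hi row low c = cut_hi row' low' c) ->
  forall p q, p < N -> q < N ->
  chain_adj row up low p q = chain_adj row' up' low' p q.
Proof.
move=> layout layout' cutE.
suff stepE p q : p < N -> q < N ->
    chain_step row up low p q = chain_step row' up' low' p q.
  by move=> p q pN qN; rewrite /chain_adj !stepE.
move=> pN qN.
apply/(chain_step_cutP layout pN qN)/(chain_step_cutP layout' pN qN).
  by case=> c cN [-> ->]; exists c => //; have [-> ->] := cutE c cN.
by case=> c cN [-> ->]; exists c => //; have [-> ->] := cutE c cN.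
Qed.

(** * Combs *)

Definition toward p c := if p < c then p.+1 else p.-1.

(* A comb is a chain whose rows are entered and left through the same position
   foot l, so that the positions foot l form its spine. *)
Section Comb.
Variables (N : nat) (row foot : nat -> nat).
Hypothesis layout : chain_layout N row foot foot.

Definition comb_dist p q :=
  if row p == row q then `|p - q|%N
  else `|p - foot (row p)| + `|row p - row q| + `|q - foot (row q)|.

(* The neighbour of p on the way to y. *)
Definition comb_closer y p :=
  if row y == row p then toward p y
  else if p != foot (row p) then toward p (foot (row p))
  else foot (toward (row p) (row y)).

Lemma comb_foot l p : l <= row N.-1 -> p < N -> l != row p ->
  foot l < N /\ row (foot l) = l.
Proof.
move=> l_max /(chain_row_max layout) rowp l_neq.
have [l_lt|l_ge] := ltnP l (row N.-1); first exact: (row_up layout).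
by apply: (row_low layout); lia.
Qed.

Lemma comb_distC p q : comb_dist p q = comb_dist q p.
Proof. by rewrite /comb_dist eq_sym; case: ifP => _; lia. Qed.

Lemma comb_dist_eq0 p q : (comb_dist p q == 0) = (p == q).
Proof.
rewrite /comb_dist; case: (row p =P row q) => [_|rowpq]; first lia.
by have [pq|] := p =P q; [rewrite pq in rowpq | lia].
Qed.

Lemma comb_dist_spine y p : p = foot (row p) ->
  comb_dist y p = `|y - foot (row y)| + `|row y - row p|.
Proof.
by rewrite /comb_dist => pE; case: eqP => [->|_]; rewrite -?pE; lia.
Qed.

Lemma comb_adjP p q : chain_adj row foot foot p q ->
  row p = row q /\ `|p - q|%N = 1 \/
  [/\ `|row p - row q|%N = 1, p = foot (row p) & q = foot (row q)].
Proof.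
case/orP=> /orP[/andP[/eqP + /eqP]|/and3P[/eqP + /eqP + /eqP]].
- by left; lia.
- by right; split; lia.
- by left; lia.
- by right; split; lia.
Qed.

Lemma comb_dist_step y p q : chain_adj row foot foot p q ->
  comb_dist y q = (comb_dist y p).+1 \/ comb_dist y p = (comb_dist y q).+1.
Proof.
case/comb_adjP=> [[rowE pq]|[rowpq pE qE]].
  by rewrite /comb_dist rowE; case: ifP => _; lia.
by rewrite !comb_dist_spine //; lia.
Qed.

Lemma comb_closer_uniq y p q : chain_adj row foot foot p q ->
  comb_dist y p = (comb_dist y q).+1 -> q = comb_closer y p.
Proof.
case/comb_adjP=> [[rowE pq]|[rowpq pE qE]].
  by rewrite /comb_dist /comb_closer /toward rowE; do !case: ifP => ?; lia.
rewrite !comb_dist_spine // => Dpq.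
rewrite /comb_closer -pE eqxx ifN /=; last by lia.
by rewrite [LHS]qE /toward; congr foot; case: ifP; lia.
Qed.

Lemma comb_step_toward p c : p < N -> c < N -> p != c -> row p = row c ->
  [/\ toward p c < N, row (toward p c) = row p
    & chain_adj row foot foot p (toward p c)].
Proof.
move=> pN cN pc rowE; have mono := chain_row_mono layout.
rewrite /toward /chain_adj /chain_step; case: ifP => p_c.
  by have := mono p p.+1; have := mono p.+1 c; split; lia.
have p1S : p.-1.+1 = p by lia.
by have := mono c p.-1; have := mono p.-1 p; rewrite p1S; split; lia.
Qed.

Lemma comb_closerP y p (q := comb_closer y p) : y < N -> p < N -> p != y ->
  [/\ q < N, chain_adj row foot foot p q & comb_dist y p = (comb_dist y q).+1].
Proof.
move=> yN pN py; rewrite {}/q /comb_closer.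
have [rowE|/eqP rowyp] := row y =P row p.
  have [qN rowq adj] := comb_step_toward pN yN py (esym rowE).
  split=> //; rewrite /comb_dist rowq rowE eqxx.
  by rewrite /toward; case: ifP; lia.
have rowpy : row p != row y by rewrite eq_sym.
have [/= pE|/= pE] := p =P foot (row p); last first.
  have [fN rowf] := comb_foot (chain_row_max layout pN) yN rowpy.
  have [qN rowq adj] := comb_step_toward pN fN (introN eqP pE) (esym rowf).
  split=> //; rewrite /comb_dist rowq (negPf rowyp).
  by rewrite /toward; case: ifP; lia.
set l := toward _ _.
have lp : `|row p - l|%N = 1 by rewrite /l /toward; case: ifP; lia.
have lmax : l <= row N.-1.
  have := chain_row_max layout pN; have := chain_row_max layout yN.
  by rewrite /l /toward; case: ifP; lia.
have [|fN rowf] := comb_foot lmax pN; first lia.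
have qE : foot l = foot (row (foot l)) by rewrite rowf.
split=> //.
  by rewrite /chain_adj /chain_step rowf -pE !eqxx !andbT; lia.
rewrite !comb_dist_spine // rowf /l /toward; case: ifP; lia.
Qed.
End Comb.

(** * Graphs numbered by the positions in a list of their vertices *)

Lemma map_index_uniq (T : eqType) (L : seq T) :
  uniq L -> map (index^~ L) L = iota 0 (size L).
Proof.
move=> uniqL; apply: (@eq_from_nth _ 0); rewrite size_map ?size_iota // => p pL.
case: L uniqL pL => // x s uniqL pL.
by rewrite (nth_map x) // index_uniq // nth_iota.
Qed.

Definition numbering (T : finType) (e : rel T) (adj : rel nat) (L : seq T) :
    Prop :=
  perm_eq L (enum T) /\ forall x y, e x y = adj (index x L) (index y L).

Section Numbering.
Variables (T : finType) (e : rel T) (adj : rel nat) (L : seq T).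
Hypothesis num : numbering e adj L.

Lemma numbering_uniq : uniq L.
Proof. by rewrite (perm_uniq num.1) enum_uniq. Qed.

Lemma numbering_mem x : x \in L.
Proof. by rewrite (perm_mem num.1) mem_enum. Qed.

Lemma numbering_index x : index x L < size L.
Proof. by rewrite index_mem numbering_mem. Qed.

Lemma numbering_index_inj : injective (index^~ L).
Proof. by move=> x y; apply: (index_inj x); apply: numbering_mem. Qed.

Lemma numbering_vertex p : p < size L -> exists x, index x L = p.
Proof.
case: L numbering_uniq => // x s uniqL pL.
by exists (nth x (x :: s) p); rewrite index_uniq.
Qed.

Lemma numbering_card (P : pred nat) :
  #|[set x | P (index x L)]| = count P (iota 0 (size L)).
Proof.
rewrite cardsE cardE size_filter -enumT -(permP num.1).
by rewrite -(map_index_uniq numbering_uniq) count_map.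
Qed.

Lemma numbering_degree x :
  degree e x = count (adj (index x L)) (iota 0 (size L)).
Proof.
by rewrite -numbering_card; apply: eq_card => y; rewrite !inE num.2.
Qed.

Lemma eq_numbering adj' :
  (forall p q, p < size L -> q < size L -> adj p q = adj' p q) ->
  numbering e adj' L.
Proof.
move=> adjE; split=> [|x y]; first exact: num.1.
by rewrite num.2 adjE ?numbering_index.
Qed.
End Numbering.

Lemma comb_numbering_tree (T : finType) (e : rel T) row foot L :
  chain_layout (size L) row foot foot ->
  numbering e (chain_adj row foot foot) L ->
  tree_metric e (fun x y => comb_dist row foot (index x L) (index y L)).
Proof.
move=> layout num; have iL := numbering_index num; split.
- by move=> x y; rewrite !num.2 /chain_adj orbC.
- move=> y x; rewrite comb_dist_eq0 eq_sym.
  by rewrite (inj_eq (numbering_index_inj num)).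
- by move=> y x z; rewrite num.2 => /comb_dist_step.
- move=> y x z z'; rewrite !num.2.
  move=> /comb_closer_uniq xz /comb_closer_uniq xz' /xz zE /xz' z'E.
  by apply: (numbering_index_inj num); rewrite zE z'E.
move=> y x xy; have [|qN adj D] := comb_closerP layout (iL y) (iL x).
  by rewrite (inj_eq (numbering_index_inj num)).
by have [z zE] := numbering_vertex num qN; exists z; rewrite ?num.2 zE.
Qed.

(** * Trees of type H as combs *)

(* The vertices u_1 .. u_s, w_2 .. w_r, v_1 .. v_t are numbered from 0 in this
   order, with i = a - 1, g = r - 1 and j = b - 1. Column 0 is the path of the
   u_k, column r = g + 1 that of the v_k, and column k consists of w_(k+1) alone
   for 0 < k < r. *)
Definition H_col (s g p : nat) : nat := minn (p.+1 - s) g.+1.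

Definition H_foot (s g i j l : nat) : nat :=
  if l == 0 then i else if l <= g then s + l.-1 else s + g + j.

Definition H_adj s g i j : rel nat :=
  chain_adj (H_col s g) (H_foot s g i j) (H_foot s g i j).

Section HComb.
Variables s g t i j : nat.
Hypotheses (i_s : i < s) (j_t : j < t).
Local Notation N := (s + g + t).

Lemma H_col_last : H_col s g N.-1 = g.+1.
Proof. by rewrite /H_col; lia. Qed.

Lemma H_foot_col l : l <= g.+1 ->
  H_foot s g i j l < N /\ H_col s g (H_foot s g i j l) = l.
Proof. by rewrite /H_foot /H_col; do !case: ifP => ?; lia. Qed.

Lemma H_layout : chain_layout N (H_col s g) (H_foot s g i j) (H_foot s g i j).
Proof.
split=> [|p _|l|l]; rewrite ?H_col_last.
- by rewrite /H_col; lia.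
- by rewrite /H_col; lia.
- by move=> ?; apply: H_foot_col; lia.
- by move=> ?; apply: H_foot_col; lia.
Qed.

Lemma H_cut_lo c : 0 < c < N ->
  cut_lo (H_col s g) (H_foot s g i j) c = if c == s then i else c.-1.
Proof. by rewrite /cut_lo /H_col /H_foot; do !case: ifP => ?; lia. Qed.

Lemma H_cut_hi c : 0 < c < N ->
  cut_hi (H_col s g) (H_foot s g i j) c = if c == s + g then s + g + j else c.
Proof. by rewrite /cut_hi /H_col /H_foot; do !case: ifP => ?; lia. Qed.

Definition H_degree p :=
  if p < s then (0 < p) + (p.+1 < s) + (p == i)
  else if p < s + g then 2
  else (s + g < p) + (p.+1 < N) + (p == s + g + j).

Lemma count_H_adj p : p < N -> count (H_adj s g i j p) (iota 0 N) = H_degree p.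
Proof.
move=> pN; rewrite (count_chain_adj H_layout pN) H_col_last /H_degree.
have [p_s|s_p] := ltnP p s.
  have -> : H_col s g p = 0 by rewrite /H_col; lia.
  have -> : (0 < p) && (H_col s g p.-1 == 0) = (0 < p) by rewrite /H_col; lia.
  have -> : (p.+1 < N) && (H_col s g p.+1 == 0) = (p.+1 < s).
    by rewrite /H_col; lia.
  by rewrite addn0.
have [p_sg|sg_p] := ltnP p (s + g).
  have -> : H_col s g p = (p - s).+1 by rewrite /H_col; lia.
  have -> : (H_col s g p.-1 == (p - s).+1) = false by rewrite /H_col; lia.
  have -> : (H_col s g p.+1 == (p - s).+1) = false by rewrite /H_col; lia.
  by rewrite /H_foot /= ifT; lia.
have -> : H_col s g p = g.+1 by rewrite /H_col; lia.
have -> : (0 < p) && (H_col s g p.-1 == g.+1) = (s + g < p).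
  by rewrite /H_col; lia.
have -> : (p.+1 < N) && (H_col s g p.+1 == g.+1) = (p.+1 < N).
  by rewrite /H_col; lia.
by rewrite ltnn /H_foot /= ifN; lia.
Qed.

Lemma H_adjE p q : p < N -> q < N ->
  H_adj s g i j p q =
  [|| path_edge (iota 0 s) p q, path_edge (iota (s + g) t) p q
    | path_edge (mkseq (H_foot s g i j) g.+2) p q].
Proof.
have stepW p' q' : p' < N -> q' < N ->
    chain_step (H_col s g) (H_foot s g i j) (H_foot s g i j) p' q' ->
    [|| path_edge (iota 0 s) p' q', path_edge (iota (s + g) t) p' q'
      | path_edge (mkseq (H_foot s g i j) g.+2) p' q'].
  rewrite !path_edge_iota => pN qN /orP[|]; first by rewrite /H_col; lia.
  case/and3P=> /eqP colE pE qE; apply/or3P/Or33/path_edge_mkseqP.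
  exists (H_col s g p'); last by left; rewrite colE; split; apply/eqP.
  by move: colE; rewrite /H_col; lia.
move=> pN qN; apply/idP/idP.
  case/orP=> /stepW; first exact.
  by rewrite 3!(path_edge_sym _ q); apply.
case/or3P; rewrite ?path_edge_iota.
- by rewrite /H_adj /chain_adj /chain_step /H_col; lia.
- by rewrite /H_adj /chain_adj /chain_step /H_col; lia.
case/path_edge_mkseqP=> k k_lt kE.
have [_ colk] := H_foot_col (ltnW k_lt : k <= g.+1).
have [_ colkS] := H_foot_col (k_lt : k.+1 <= g.+1).
rewrite /H_adj /chain_adj /chain_step.
by case: kE => -[-> ->]; rewrite colk colkS !eqxx ?orbT.
Qed.

Lemma mkseq_H_foot :
  mkseq (H_foot s g i j) g.+2 = i :: rcons (iota s g) (s + g + j).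
Proof.
rewrite mkseqS /mkseq /=; congr (_ :: rcons _ _).
  rewrite (iotaDl 1 0) -map_comp -{2}[s]addn0 iotaDl.
  apply/eq_in_map => l; rewrite mem_iota => /andP[_ l_g].
  by rewrite /H_foot /= ifT.
by rewrite /H_foot ltnn.
Qed.
End HComb.

Definition H_numbering (T : finType) (e : rel T) s g t i j L :=
  size L = s + g + t /\ numbering e (H_adj s g i j) L.

Section HLists.
Variables (T : finType) (e : rel T) (x0 : T).
Implicit Types us ms vs : seq T.

(* The three lists are u_1 .. u_s, w_2 .. w_r and v_1 .. v_t, and i = a - 1,
   j = b - 1. *)
Definition type_H_lists us ms vs i j : Prop :=
  perm_eq (us ++ ms ++ vs) (enum T) /\
  forall x y, e x y = [|| path_edge us x y, path_edge vs x y
    | path_edge (nth x0 us i :: rcons ms (nth x0 vs j)) x y].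

Lemma type_H_lists_revl us ms vs i j : i < size us ->
  type_H_lists us ms vs i j -> type_H_lists (rev us) ms vs (size us - i.+1) j.
Proof.
move=> i_us [perm ed]; split=> [|x y].
  by apply: perm_trans perm; rewrite perm_cat2r perm_rev.
rewrite ed path_edge_rev nth_rev; last lia.
by have -> : size us - (size us - i.+1).+1 = i by lia.
Qed.

Lemma type_H_lists_revr us ms vs i j : j < size vs ->
  type_H_lists us ms vs i j -> type_H_lists us ms (rev vs) i (size vs - j.+1).
Proof.
move=> j_vs [perm ed]; split=> [|x y].
  by apply: perm_trans perm; rewrite !perm_cat2l perm_rev.
rewrite ed path_edge_rev nth_rev; last lia.
by have -> : size vs - (size vs - j.+1).+1 = j by lia.
Qed.

Lemma type_H_listsP s t r a b :
  0 < r -> 0 < a <= s -> 0 < b <= t -> is_type_H e s t r a b ->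
  exists us ms vs, [/\ size us = s, size ms = r - 1, size vs = t
    & type_H_lists us ms vs (a - 1) (b - 1)].
Proof.
move=> r_gt0 a_s b_t [u [v [w [ua vb perm ed]]]].
exists (map u (iota 1 s)), (map w (iota 2 r.-1)), (map v (iota 1 t)).
rewrite !size_map !size_iota subn1; split=> //; split=> [|x y].
  by apply: perm_trans perm; rewrite perm_cat2l perm_catC.
rewrite ed !(nth_map 0) ?size_iota ?nth_iota; try lia.
rewrite !add1n !subn1 !prednK; try lia.
have -> : iota 1 r.+1 = 1 :: rcons (iota 2 r.-1) r.+1.
  case: r r_gt0 {vb ed perm} => // r _.
  by rewrite -cats1 -[[:: r.+2]]/(iota (2 + r) 1) -iotaD addn1.
by rewrite ua vb map_cons map_rcons.
Qed.

Lemma type_H_lists_numbering us ms vs i j : i < size us -> j < size vs ->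
  type_H_lists us ms vs i j ->
  H_numbering e (size us) (size ms) (size vs) i j (us ++ ms ++ vs).
Proof.
move=> i_us j_vs [perm ed]; set L := us ++ ms ++ vs in perm *.
have uniqL : uniq L by rewrite (perm_uniq perm) enum_uniq.
have memL x : x \in L by rewrite (perm_mem perm) mem_enum.
have sizeL : size L = size us + size ms + size vs by rewrite !size_cat addnA.
have [us_pos ms_pos vs_pos] : [/\ map (index^~ L) us = iota 0 (size us),
    map (index^~ L) ms = iota (size us) (size ms)
  & map (index^~ L) vs = iota (size us + size ms) (size vs)].
  have /eqP := map_index_uniq uniqL; rewrite sizeL -addnA !iotaD !map_cat.
  rewrite !eqseq_cat ?size_map ?size_iota //.
  by case/and3P=> /eqP-> /eqP-> /eqP->.
have bridge_pos : map (index^~ L) (nth x0 us i :: rcons ms (nth x0 vs j)) =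
    mkseq (H_foot (size us) (size ms) i j) (size ms).+2.
  rewrite mkseq_H_foot map_cons map_rcons ms_pos; congr (_ :: rcons _ _).
    rewrite index_cat mem_nth // index_uniq //.
    by move: uniqL; rewrite cat_uniq => /andP[].
  have <- : nth x0 L (size us + size ms + j) = nth x0 vs j.
    by rewrite -addnA /L; do 2!rewrite nth_cat ltnNge leq_addr /= addKn.
  by rewrite index_uniq // sizeL ltn_add2l.
have index_inj : injective (index^~ L) by move=> x y; apply: (index_inj x).
split=> //; split=> // x y.
rewrite (H_adjE i_us j_vs) -?sizeL ?index_mem // ed -us_pos -vs_pos -bridge_pos.
by rewrite !(path_edge_map _ _ _ index_inj).
Qed.
End HLists.

Lemma type_H_numbering (T : finType) (e : rel T) (s t r a b i j : nat) :
  0 < r -> 0 < a <= s -> 0 < b <= t -> is_type_H e s t r a b ->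
  i = a - 1 \/ i = s - a -> j = b - 1 \/ j = t - b ->
  exists L, H_numbering e s (r - 1) t i j L.
Proof.
move=> r_gt0 a_s b_t hT iE jE; have [u _] := hT.
have [us [ms [vs [us_s ms_g vs_t lists]]]] :=
  type_H_listsP (u 0) r_gt0 a_s b_t hT.
have {lists} [us' [us'_s lists]] : exists us', size us' = s /\
    type_H_lists e (u 0) us' ms vs i (b - 1).
  case: iE => ->; first by exists us.
  exists (rev us); rewrite size_rev; split=> //.
  have -> : s - a = size us - (a - 1).+1 by lia.
  by apply: type_H_lists_revl lists; lia.
have {lists} [vs' [vs'_t lists]] : exists vs', size vs' = t /\
    type_H_lists e (u 0) us' ms vs' i j.
  case: jE => ->; first by exists vs.
  exists (rev vs); rewrite size_rev; split=> //.
  have -> : t - b = size vs - (b - 1).+1 by lia.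
  by apply: type_H_lists_revr lists; lia.
exists (us' ++ ms ++ vs'); rewrite -us'_s -ms_g -vs'_t.
by apply: type_H_lists_numbering lists; lia.
Qed.

(** * Uniqueness of the parameters *)

Lemma count_iota_interval a n N : a + n <= N ->
  count (fun p => a <= p < a + n) (iota 0 N) = n.
Proof.
move=> aN; rewrite -size_filter -[RHS](size_iota a).
apply/perm_size/uniq_perm => [||p]; rewrite ?filter_uniq ?iota_uniq //.
by rewrite mem_filter !mem_iota; lia.
Qed.

(* In a tree, the vertices that a path from w' reaches through w. *)
Definition side (T : finType) (e : rel T) (w w' : T) : {set T} :=
  [set x | dist e w' x == dist e w x + dist e w w'].

Definition arm (T : finType) (e : rel T) (w w' : T) : nat * nat :=
  (#|side e w w'|, \max_(x in side e w w') dist e w x).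

(* This pair determines i up to the reversal of a path with s vertices. *)
Definition arm_shape (s i : nat) : nat * nat := (s, maxn i (s - 1 - i)).

Section HInvariants.
Variables (T : finType) (e : rel T) (s g t i j : nat) (L : seq T).
Hypotheses (i_s : i < s) (j_t : j < t) (numL : H_numbering e s g t i j L).

Let sizeL : size L = s + g + t := numL.1.
Let num : numbering e (H_adj s g i j) L := numL.2.

Lemma H_numbering_tree :
  tree_metric e (fun x y =>
    comb_dist (H_col s g) (H_foot s g i j) (index x L) (index y L)).
Proof. by apply: comb_numbering_tree num; rewrite sizeL; apply: H_layout. Qed.

Lemma H_numbering_degree x : degree e x = H_degree s g t i j (index x L).
Proof.
rewrite (numbering_degree num) sizeL; apply: count_H_adj => //.
by rewrite -sizeL (numbering_index num).
Qed.

Lemma H_numbering_degree_le3 x : degree e x <= 3.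
Proof. by rewrite H_numbering_degree /H_degree; do !case: ifP => ?; lia. Qed.

Lemma H_numbering_branch x :
  degree e x = 3 <->
  index x L = i /\ 0 < i < s - 1 \/ index x L = s + g + j /\ 0 < j < t - 1.
Proof.
have := numbering_index num x; rewrite sizeL H_numbering_degree /H_degree.
by do !case: ifP => ?; lia.
Qed.

Lemma dist_H_foot w l x : l <= g.+1 -> index w L = H_foot s g i j l ->
  dist e w x = `|l - H_col s g (index x L)| +
               `|index x L - H_foot s g i j (H_col s g (index x L))|.
Proof.
move=> l_g wE; rewrite (tree_metric_dist H_numbering_tree) wE.
have [_ colw] := H_foot_col i_s j_t l_g.
by rewrite comb_distC comb_dist_spine colw //; lia.
Qed.

Lemma side_H_foot w w' l x : l == 0 \/ l == g.+1 ->
  index w L = H_foot s g i j l -> index w' L = H_foot s g i j (g.+1 - l) ->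
  (x \in side e w w') = (H_col s g (index x L) == l).
Proof.
move=> l_end wE w'E; have l_max : l <= g.+1 by lia.
have l'_max : g.+1 - l <= g.+1 by lia.
rewrite inE (dist_H_foot x l'_max w'E) !(dist_H_foot _ l_max wE).
have [_ colw'] := H_foot_col i_s j_t l'_max.
have : H_col s g (index x L) <= g.+1 by rewrite /H_col; lia.
by rewrite w'E colw'; lia.
Qed.

Lemma interval_arm w w' a n c : a + n <= s + g + t -> c < n ->
  (forall x, (x \in side e w w') = (a <= index x L < a + n)) ->
  (forall x, x \in side e w w' -> dist e w x = `|index x L - (a + c)|%N) ->
  arm e w w' = arm_shape n c.
Proof.
move=> aN c_n sideE distE; rewrite /arm /arm_shape; congr (_, _).
  rewrite -(count_iota_interval aN) -sizeL -(numbering_card num).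
  by apply: eq_card => x; rewrite sideE inE.
have [first firstE] : exists x, index x L = a.
  by apply: (numbering_vertex num); lia.
have [last lastE] : exists x, index x L = a + n.-1.
  by apply: (numbering_vertex num); lia.
apply/eqP; rewrite eqn_leq; apply/andP; split.
  by apply/bigmax_leqP => x xw; rewrite distE //; move: xw; rewrite sideE; lia.
have dist_max x : x \in side e w w' ->
    dist e w x <= \max_(z in side e w w') dist e w z.
  by move=> xw; apply: leq_bigmax_cond.
have := dist_max first; have := dist_max last.
have := distE first; have := distE last.
by rewrite !sideE firstE lastE; lia.
Qed.

Lemma H_foot_arm w w' l a n c : l == 0 \/ l == g.+1 ->
  index w L = H_foot s g i j l -> index w' L = H_foot s g i j (g.+1 - l) ->
  H_foot s g i j l = a + c -> c < n -> a + n <= s + g + t ->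
  (forall p, p < s + g + t -> (H_col s g p == l) = (a <= p < a + n)) ->
  dist e w w' = g.+1 /\ arm e w w' = arm_shape n c.
Proof.
move=> l_end wE w'E footE c_n aN colE; have l_max : l <= g.+1 by lia.
split.
  rewrite (dist_H_foot w' l_max wE) w'E.
  by have [_ ->] := H_foot_col i_s j_t (leq_subr l g.+1); lia.
have sideE x := side_H_foot x l_end wE w'E.
apply: (interval_arm aN c_n) => x.
  by rewrite sideE colE // -sizeL (numbering_index num).
rewrite sideE => /eqP colx.
by rewrite (dist_H_foot x l_max wE) colx footE; lia.
Qed.

Lemma H_numbering_arms w1 w2 : index w1 L = i -> index w2 L = s + g + j ->
  [/\ dist e w1 w2 = g.+1, arm e w1 w2 = arm_shape s i,
      dist e w2 w1 = g.+1 & arm e w2 w1 = arm_shape t j].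
Proof.
have footS : H_foot s g i j g.+1 = s + g + j by rewrite /H_foot ltnn.
move=> w1E w2E.
have [|||||||-> ->] := @H_foot_arm w1 w2 0 0 s i; rewrite ?subn0 ?footS //.
- by left.
- by lia.
- by move=> p _; rewrite /H_col; lia.
have [|||||||-> ->] := @H_foot_arm w2 w1 g.+1 (s + g) t j;
  rewrite ?subnn ?footS //.
- by right.
- by move=> p pN; rewrite /H_col; lia.
Qed.
End HInvariants.

Lemma H_numbering_params (T : finType) (e : rel T)
    s g t i j s' g' t' i' j' L L' :
  0 < i < s - 1 -> 0 < j < t - 1 -> i' < s' -> j' < t' ->
  H_numbering e s g t i j L -> H_numbering e s' g' t' i' j' L' ->
  g = g' /\
  (arm_shape s i = arm_shape s' i' /\ arm_shape t j = arm_shape t' j' \/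
   arm_shape s i = arm_shape t' j' /\ arm_shape t j = arm_shape s' i').
Proof.
move=> i_int j_int i_s' j_t' num num'; have [i_s j_t] : i < s /\ j < t by lia.
have [w1 w1E] : exists x, index x L = i.
  by apply: (numbering_vertex num.2); rewrite num.1; lia.
have [w2 w2E] : exists x, index x L = s + g + j.
  by apply: (numbering_vertex num.2); rewrite num.1; lia.
have deg1 : degree e w1 = 3 by apply/(H_numbering_branch i_s j_t num); left.
have deg2 : degree e w2 = 3 by apply/(H_numbering_branch i_s j_t num); right.
have branch x : degree e x = 3 ->
    index x L' = i' \/ index x L' = s' + g' + j'.
  by move/(H_numbering_branch i_s' j_t' num' x).1; lia.
have w12 : index w1 L' <> index w2 L'.
  by move/(numbering_index_inj num'.2) => w12; rewrite w12 w2E in w1E; lia.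
have [dist12 arm12 dist21 arm21] := H_numbering_arms i_s j_t num w1E w2E.
have arms' := H_numbering_arms i_s' j_t' num'.
have [w1E'|w1E'] := branch w1 deg1; have [w2E'|w2E'] := branch w2 deg2.
- by rewrite w1E' w2E' in w12.
- have [dist12' arm12' _ arm21'] := arms' _ _ w1E' w2E'.
  by split; [lia | left; rewrite -arm12 -arm21].
- have [_ arm21' dist12' arm12'] := arms' _ _ w2E' w1E'.
  by split; [lia | right; rewrite -arm12 -arm21].
- by rewrite w1E' w2E' in w12.
Qed.

(** * Chains of rows of given lengths *)

Section Rows.
Variables (sh : seq nat) (d : nat -> nat).
Local Notation k l := (nth 0 sh l).
Local Notation pos := (flatten_index sh).
Local Notation row := (reshape_index sh).

(* Rows are read in the reverse of their order in a linear configuration, so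
   that the vertex at distance d from the start of row l is linked to the vertex
   at distance d from the end of row l.+1, see link_edgeP. *)
Definition row_exit l := pos l (d l).
Definition row_entry l := pos l (k l - (d l.-1).+1).

Lemma row_exitE l : row_exit l = pos l 0 + d l.
Proof. by rewrite /row_exit /flatten_index addn0. Qed.

Lemma row_entryE l : row_entry l = pos l 0 + (k l - (d l.-1).+1).
Proof. by rewrite /row_entry /flatten_index addn0. Qed.

Definition rows_step : rel nat := chain_step row row_exit row_entry.
Definition rows_adj : rel nat := chain_adj row row_exit row_entry.

Lemma reshape_index_eq p l : p < sumn sh ->
  (row p == l) = (pos l 0 <= p < pos l (k l)).
Proof.
move=> pN; apply/eqP/idP => [<-|p_l].
  rewrite -{2 3}(reshape_indexK sh p) /flatten_index ltn_add2l leq_add2l.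
  exact: reshape_offsetP.
have -> : p = pos l (p - pos l 0) by move: p_l; rewrite /flatten_index; lia.
by rewrite flatten_indexKl //; move: p_l; rewrite /flatten_index; lia.
Qed.

Lemma flatten_index_next l : l < size sh -> pos l.+1 0 = pos l (k l).
Proof.
by move=> l_sh; rewrite /flatten_index (take_nth 0) // sumn_rcons addn0.
Qed.

Hypothesis sh_gt0 : 0 \notin sh.

Lemma row_length_gt0 l : l < size sh -> 0 < k l.
Proof.
move=> l_sh; rewrite lt0n; apply: contraNneq sh_gt0 => <-.
exact: mem_nth.
Qed.

Lemma row_start_eq l l' : l < size sh -> l' < size sh ->
  (pos l 0 == pos l' 0) = (l == l').
Proof.
move=> l_sh l'_sh; apply/eqP/eqP => [/(congr1 row)|->//].
by rewrite !flatten_indexKl // row_length_gt0.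
Qed.

Lemma reshape_index_succ p : p.+1 < sumn sh -> row p <= row p.+1 <= (row p).+1.
Proof.
move=> pN; have pN' := ltnW pN; set l := row p.
have : row p == l by []; rewrite reshape_index_eq // => p_l.
have [|] := boolP (row p.+1 == l); first lia.
rewrite reshape_index_eq // => pS_l.
have l_sh : l < size sh by apply: reshape_indexP.
suff /eqP -> : row p.+1 == l.+1 by lia.
rewrite reshape_index_eq // flatten_index_next //.
have lS_sh : l.+1 < size sh.
  move: pN; apply: contraTltn => sh_l; rewrite -leqNgt.
  have -> : sumn sh = pos l.+1 0.
    by rewrite /flatten_index take_oversize // addn0.
  by rewrite flatten_index_next //; lia.
have := row_length_gt0 lS_sh; have := flatten_index_next l_sh.
by move: p_l pS_l; rewrite /flatten_index; lia.
Qed.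

Lemma reshape_index_last : 0 < size sh -> row (sumn sh).-1 = (size sh).-1.
Proof.
move=> sh_n0; set l := (size sh).-1; have l_sh : l < size sh by rewrite /l; lia.
have k_gt0 := row_length_gt0 l_sh.
have sumE : sumn sh = pos l (k l).
  have lS : l.+1 = size sh by rewrite /l prednK.
  by rewrite -flatten_index_next // lS /flatten_index take_size addn0.
have -> : (sumn sh).-1 = pos l (k l).-1 by rewrite sumE /flatten_index; lia.
by rewrite flatten_indexKl // prednK.
Qed.

Lemma rows_cutP c (lo := cut_lo row row_exit c)
    (hi := cut_hi row row_entry c) : 0 < c < sumn sh ->
  [/\ forall l, l < size sh -> c != pos l 0, lo = c.-1 & hi = c] \/
  (exists l, [/\ l.+1 < size sh, c = pos l.+1 0, lo = row_exit l
    & hi = row_entry l.+1]).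
Proof.
case/andP=> c_gt0 cN; have c1N : c.-1 < sumn sh by lia.
have := reshape_index_succ (p := c.-1); rewrite prednK // => /(_ cN).
have := reshape_indexK sh c.-1; have := reshape_offsetP c1N.
rewrite /lo /hi /cut_lo /cut_hi.
have [rowE|/eqP rowE] := row c.-1 =P row c => off_k offK row_c; [left | right].
  split=> // l l_sh; apply/eqP=> cE.
  have row_cl : row c = l by rewrite cE flatten_indexKl ?row_length_gt0.
  by have := reshape_index_eq l c1N; rewrite rowE row_cl eqxx -cE; lia.
exists (row c.-1); have row_cS : row c = (row c.-1).+1 by lia.
have l_sh : (row c.-1).+1 < size sh by rewrite -row_cS reshape_indexP.
rewrite -row_cS; split=> //; first exact: reshape_indexP.
have := reshape_index_eq (row c) cN; rewrite eqxx => /esym.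
rewrite row_cS flatten_index_next; last exact: ltnW.
by move: off_k offK; rewrite /flatten_index; lia.
Qed.

Definition links_fit :=
  forall l, l.+1 < size sh -> 0 < d l < minn (k l) (k l.+1).

Hypothesis fit : links_fit.

Lemma rows_layout : chain_layout (sumn sh) row row_exit row_entry.
Proof.
have [/size0nil ->|sh_n0] := posnP (size sh).
  by split=> // l; rewrite /reshape_index /=; lia.
split=> [|p pN|l|l]; rewrite ?reshape_index_last //.
- have := flatten_indexKl (row_length_gt0 sh_n0).
  by rewrite /flatten_index take0.
- exact: reshape_index_succ.
- move=> l_sh; have d_lt : d l < k l.
    by have : l.+1 < size sh by [lia]; move/fit; lia.
  by rewrite /row_exit flatten_indexKl // flatten_indexP.
- move=> l_sh; have lt_k : k l - (d l.-1).+1 < k l.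
    by have := @row_length_gt0 l; lia.
  by rewrite /row_entry flatten_indexKl // flatten_indexP.
Qed.

Definition row_degree l c :=
  (0 < c) + (c.+1 < k l) + ((l.+1 < size sh) && (c == d l)) +
  ((0 < l) && (c + (d l.-1).+1 == k l)).

Lemma count_rows_adj l c : l < size sh -> c < k l ->
  count (rows_adj (pos l c)) (iota 0 (sumn sh)) = row_degree l c.
Proof.
move=> l_sh c_k; have pN := flatten_indexP c_k.
rewrite (count_chain_adj rows_layout) // reshape_index_last; last by lia.
rewrite flatten_indexKl //.
have -> : (0 < pos l c) && (row (pos l c).-1 == l) = (0 < c).
  by rewrite reshape_index_eq; move: pN; rewrite /flatten_index; lia.
have -> : ((pos l c).+1 < sumn sh) && (row (pos l c).+1 == l) = (c.+1 < k l).
  have [pSN|pSN] := ltnP (pos l c).+1 (sumn sh).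
    by rewrite reshape_index_eq //= /flatten_index; lia.
  apply/esym/negbTE; rewrite -leqNgt leqNgt; apply/negP=> /flatten_indexP.
  by move: pSN; rewrite /flatten_index; lia.
rewrite /row_degree /row_exit /row_entry.
have d_lt : 0 < l -> d l.-1 < k l.
  by case: l l_sh {c_k pN} => //= l /fit; lia.
by rewrite !eqn_add2l; lia.
Qed.
End Rows.

Lemma notin_shape (T : eqType) (R : seq (seq T)) :
  (0 \notin shape R) = ([::] \notin R).
Proof.
congr (~~ _); apply/mapP/idP => [[P PR /esym/size0nil <-] //|PR].
by exists [::].
Qed.

Lemma uniq_flatten_row (T : eqType) (R : seq (seq T)) l :
  uniq (flatten R) -> uniq (nth [::] R l).
Proof.
have [l_R|R_l] := ltnP l (size R); last by rewrite nth_default.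
rewrite -{1}(cat_take_drop l R) (drop_nth [::]) // flatten_cat /= !cat_uniq.
by case/and3P=> _ _ /andP[].
Qed.

Lemma index_flatten (T : eqType) (x0 : T) (R : seq (seq T)) l c :
  uniq (flatten R) -> c < size (nth [::] R l) ->
  index (nth x0 (nth [::] R l) c) (flatten R) = flatten_index (shape R) l c.
Proof.
rewrite -nth_shape => uniqR c_lt.
have pN := flatten_indexP c_lt.
have <- : nth x0 (flatten R) (flatten_index (shape R) l c) =
          nth x0 (nth [::] R l) c.
  by rewrite nth_flatten flatten_indexKl // flatten_indexKr.
by rewrite index_uniq // size_flatten.
Qed.

Lemma mem_flatten_row (T : eqType) (R : seq (seq T)) l x :
  uniq (flatten R) -> l < size R -> x \in flatten R ->
  (x \in nth [::] R l) = (reshape_index (shape R) (index x (flatten R)) == l).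
Proof.
move=> uniqR l_R xR; have pN : index x (flatten R) < sumn (shape R).
  by rewrite -size_flatten index_mem.
apply/idP/eqP => [/(nthP x)[c c_lt <-]|<-].
  by rewrite index_flatten // flatten_indexKl // nth_shape.
rewrite -{1}(nth_index x xR) nth_flatten mem_nth // -nth_shape.
exact: reshape_offsetP.
Qed.

Lemma flatten_coordP (T : eqType) (x0 : T) (R : seq (seq T)) x :
  x \in flatten R -> exists l c,
  [/\ l < size R, c < size (nth [::] R l), x = nth x0 (nth [::] R l) c
    & index x (flatten R) = flatten_index (shape R) l c].
Proof.
move=> xR; have xN : index x (flatten R) < sumn (shape R).
  by rewrite -size_flatten index_mem.
exists (reshape_index (shape R) (index x (flatten R))).
exists (reshape_offset (shape R) (index x (flatten R))).
rewrite reshape_indexK -nth_flatten nth_index // -nth_shape.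
by rewrite reshape_offsetP // -(size_map size) reshape_indexP.
Qed.

Definition exit_vertex (T : Type) (R : seq (seq T)) (x0 : T) l d :=
  nth x0 (nth [::] R l) d.

Definition entry_vertex (T : Type) (R : seq (seq T)) (x0 : T) l d :=
  nth x0 (nth [::] R l.+1) (size (nth [::] R l.+1) - d.+1).

Lemma rows_stepP (T : eqType) (R : seq (seq T)) d (x0 x y : T) :
  uniq (flatten R) -> links_fit (shape R) d ->
  x \in flatten R -> y \in flatten R ->
  rows_step (shape R) d (index x (flatten R)) (index y (flatten R)) <->
  (exists l c, [/\ c.+1 < size (nth [::] R l), x = nth x0 (nth [::] R l) c
     & y = nth x0 (nth [::] R l) c.+1]) \/
  (exists l, [/\ l.+1 < size R, x = exit_vertex R x0 l (d l)
     & y = entry_vertex R x0 l (d l)]).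
Proof.
move=> uniq_R fit xR yR; split.
  have [l [c [l_R c_l -> xE]]] := flatten_coordP x0 xR.
  have [l' [c' [l'_R c'_l -> yE]]] := flatten_coordP x0 yR.
  rewrite xE yE /rows_step /chain_step !flatten_indexKl ?nth_shape //.
  case/orP=> [/andP[/eqP pqE /eqP ll']|/and3P[/eqP lS]].
    left; exists l, c; move: pqE c'_l; rewrite -ll' /flatten_index -addnS.
    by move/eqP; rewrite eqn_add2l => /eqP <-.
  rewrite /row_exit /row_entry -lS !eqn_add2l nth_shape lS => /eqP -> /eqP ->.
  by right; exists l; rewrite /entry_vertex lS; split=> //; rewrite -lS.
case=> [[l [c [c_l -> ->]]]|[l [l_R -> ->]]].
  rewrite !index_flatten //; last exact: ltnW.
  rewrite /rows_step /chain_step !flatten_indexKl ?nth_shape //; last first.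
    exact: ltnW.
  by rewrite /flatten_index addnS !eqxx.
have := fit l; rewrite size_map !nth_shape => /(_ l_R) d_l.
have exit_lt : d l < size (nth [::] R l) by lia.
have entry_lt : size (nth [::] R l.+1) - (d l).+1 < size (nth [::] R l.+1).
  by lia.
rewrite !index_flatten // /rows_step /chain_step.
rewrite !flatten_indexKl ?nth_shape // !eqxx /=.
by rewrite /row_exit /row_entry nth_shape !eqxx orbT.
Qed.

(** * Linear configurations as chains of rows *)

Lemma link_edgeP (T : finType) (e : rel T) D (P Q : seq T) x y :
  tree_metric e D -> sorted e P -> uniq P -> sorted e Q -> uniq Q ->
  link_edge e P Q x y <->
  exists d, [/\ 0 < d < minn (size P) (size Q), x = nth x P (size P - d.+1)
             & y = nth y Q d].
Proof.
move=> tree sP uP sQ uQ.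
have distP i : i < size P -> dist e (nth x P i) (last x P) = size P - i.+1.
  move=> i_P; rewrite -nth_last (tree_dist_in_path tree) //; lia.
have distQ i : i < size Q -> dist e (head y Q) (nth y Q i) = i.
  by move=> i_Q; rewrite -nth0 (tree_dist_in_path tree) ?subn0.
split=> [[i [d [i_P d_Q xE yE distE]]]|[d [d_lt xE yE]]].
  have d_lt : d < size Q by case/andP: d_Q.
  exists d; move: distE; rewrite {1}xE {2}yE distP ?distQ //.
  by move=> distE; split=> //; [lia | rewrite {1}xE; congr nth; lia].
exists (size P - d.+1), d; split=> //; try lia.
by rewrite {1}xE {2}yE distP ?distQ; lia.
Qed.

Lemma linear_configuration_rev (T : finType) (e : rel T) (R : seq (seq T)) :
  linear_configuration e (rev R) <->
  [/\ [::] \notin R, perm_eq (flatten R) (enum T), {in R, forall P, sorted e P}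
    & forall x y, e x y -> ~~ has (fun P => path_edge P x y) R ->
      exists2 l, l.+1 < size R &
        link_edge e (nth [::] R l.+1) (nth [::] R l) x y \/
        link_edge e (nth [::] R l.+1) (nth [::] R l) y x].
Proof.
have nth_revR l : l.+1 < size R ->
    nth [::] (rev R) l = nth [::] R (size R - l.+2).+1 /\
    nth [::] (rev R) l.+1 = nth [::] R (size R - l.+2).
  by move=> l_R; rewrite !nth_rev //; [split=> //; congr nth; lia | lia].
have sorted_rev :
    (forall P, P \in rev R -> sorted e P) <-> {in R, forall P, sorted e P}.
  by split=> sR P; [rewrite -mem_rev | rewrite mem_rev]; apply: sR.
rewrite /linear_configuration mem_rev.
have /permPl -> : perm_eq (flatten (rev R)) (flatten R).
  by apply: perm_flatten; rewrite perm_rev.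
split=> [] [nR permR sR linkR]; split=> //; try exact/sorted_rev;
  move=> x y exy.
  rewrite -has_rev => /(linkR _ _ exy)[l]; rewrite size_rev => l_R.
  by have [-> ->] := nth_revR l l_R; exists (size R - l.+2) => //; lia.
rewrite has_rev => /(linkR _ _ exy)[l l_R link]; exists (size R - l.+2).
  by rewrite size_rev; lia.
have [|-> ->] := nth_revR (size R - l.+2); first by lia.
by have -> : size R - (size R - l.+2).+2 = l by lia.
Qed.

Section Configuration.
Variables (T : finType) (e : rel T) (D : T -> T -> nat).
Variables (R : seq (seq T)) (x0 : T).
Hypotheses (tree : tree_metric e D) (conf : linear_configuration e (rev R)).
Local Notation row l := (nth [::] R l).
Local Notation exit_vertex := (exit_vertex R x0).
Local Notation entry_vertex := (entry_vertex R x0).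

Definition linked l d :=
  (0 < d < minn (size (row l)) (size (row l.+1))) &&
  e (exit_vertex l d) (entry_vertex l d).

Let perm_rows : perm_eq (flatten R) (enum T).
Proof. by case/linear_configuration_rev: conf. Qed.

Let uniq_rows : uniq (flatten R).
Proof. by rewrite (perm_uniq perm_rows) enum_uniq. Qed.

Let mem_rows x : x \in flatten R.
Proof. by rewrite (perm_mem perm_rows) mem_enum. Qed.

Let row_sorted l : l < size R -> sorted e (row l).
Proof.
move=> l_R; case/linear_configuration_rev: conf => _ _ sorted_R _.
exact/sorted_R/mem_nth.
Qed.

Let row_uniq l : uniq (row l) := uniq_flatten_row l uniq_rows.

Let mem_row x l : l < size R ->
  (x \in row l) = (reshape_index (shape R) (index x (flatten R)) == l).
Proof. by move=> l_R; apply: (mem_flatten_row uniq_rows l_R (mem_rows x)). Qed.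

Lemma configuration_edge x y : e x y ->
  (exists2 l, l < size R & path_edge (row l) x y) \/
  (exists l d, [/\ l.+1 < size R, linked l d
    & x = exit_vertex l d /\ y = entry_vertex l d \/
      y = exit_vertex l d /\ x = entry_vertex l d]).
Proof.
move=> exy; case/linear_configuration_rev: conf => _ _ _ linkR.
have [/(has_nthP [::])[l l_R xy_row]|no_row] :=
  boolP (has (fun P => path_edge P x y) R).
  by left; exists l.
right; have [l l_R link] := linkR x y exy no_row; exists l.
have linkP z z' : e z z' -> link_edge e (row l.+1) (row l) z' z ->
    exists2 d, linked l d & z = exit_vertex l d /\ z' = entry_vertex l d.
  move=> ezz' /(link_edgeP _ _ tree (row_sorted l_R) (row_uniq _)
    (row_sorted (ltnW l_R)) (row_uniq _))[d [d_lt z'E zE]].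
  have {}zE : z = exit_vertex l d by rewrite zE; apply: set_nth_default; lia.
  have {}z'E : z' = entry_vertex l d.
    by rewrite z'E; apply: set_nth_default; lia.
  by exists d; rewrite // /linked -zE -z'E ezz' andbT minnC.
case: link => [/linkP|/linkP] [|d ld xy]; rewrite ?(tree_sym tree y) //.
  by exists d; split=> //; right.
by exists d; split=> //; left.
Qed.

Let mem_linked l d :
  linked l d -> exit_vertex l d \in row l /\ entry_vertex l d \in row l.+1.
Proof.
case/andP=> /andP[_]; rewrite ltn_min => /andP[d_l d_lS] _.
by rewrite !mem_nth // ltn_subrL /= (leq_ltn_trans _ d_lS).
Qed.

Lemma configuration_link_exists l : l.+1 < size R -> exists d, linked l d.
Proof.
move=> l_R; have [/hasP[d _ ld]|no_link] :=
  boolP (has (linked l) (iota 0 (size (row l)))); first by exists d.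
pose S x := reshape_index (shape R) (index x (flatten R)) <= l.
have row_vertex k : k < size R -> exists x, x \in row k.
  move=> k_R; case/linear_configuration_rev: conf => R_n0 _ _ _.
  case E : (row k) => [|x P]; last by exists x; rewrite mem_head.
  by case/negP: R_n0; rewrite -E mem_nth.
have [y] := row_vertex l (ltnW l_R); rewrite mem_row 1?ltnW // => /eqP y_l.
have [z] := row_vertex l.+1 l_R; rewrite mem_row // => /eqP z_l.
suff : S z by rewrite /S z_l ltnn.
apply: (tree_connected tree (y := y)); first by rewrite /S y_l.
suff S_edge u v : e u v -> S v = S u by move=> u v Su /S_edge ->.
case/configuration_edge=> [[k k_R /(path_edgeP x0)[c c_lt uv]]|
                           [k [d [k_R kd uv]]]].
  have [] : u \in row k /\ v \in row k.
    by case: uv => [] [-> ->]; rewrite !mem_nth // ltnW.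
  by rewrite /S !mem_row // => /eqP -> /eqP ->.
have [] := mem_linked kd; rewrite !mem_row ?(ltnW k_R) //.
move=> /eqP exit_k /eqP entry_k.
have kl : k != l.
  apply: contraNneq no_link => kl; apply/hasP; exists d; rewrite -?kl //.
  by rewrite mem_iota; case/andP: kd; lia.
by case: uv => [] [-> ->]; rewrite /S exit_k entry_k; lia.
Qed.

Lemma configuration_link_uniq l d d' : l.+1 < size R ->
  linked l d -> linked l d' -> d = d'.
Proof.
move=> l_R; wlog: d d' / d < d' => [W ld ld'|d_d'].
  by have [d_d'|d'_d|//] := ltngtP d d'; [apply: W | apply/esym/W].
case/andP=> d_lt link /andP[d'_lt link'].
set entry := entry_vertex l; set exit := exit_vertex l.
have entry_range :
    size (row l.+1) - d'.+1 <= size (row l.+1) - d.+1 < size (row l.+1).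
  by lia.
have exit_range : d <= d' < size (row l) by lia.
have [p [ep pE up sp pP]] :=
  sorted_segment x0 (row_sorted l_R) (row_uniq _) entry_range.
have [q [eq qE uq sq qP]] :=
  sorted_segment x0 (row_sorted (ltnW l_R)) (row_uniq _) exit_range.
have disjoint_pq : ~~ has [in entry d' :: p] (exit d :: q).
  apply/hasPn => x /qP x_l; apply/negP=> /pP; move: x_l.
  by rewrite !mem_row ?(ltnW l_R) // => /eqP -> /eqP; lia.
have := @tree_simple_path_chord _ _ _ tree (entry d') (p ++ exit d :: q).
rewrite -cat_cons cat_uniq up disjoint_pq uq cat_path ep last_cat size_cat sp.
rewrite /= pE qE eq (tree_sym tree (entry d)) link (tree_sym tree) link' /=.
by move=> /(_ isT isT); lia.
Qed.
End Configuration.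

Lemma configuration_numbering (T : finType) (e : rel T) D R :
  0 < #|T| -> tree_metric e D -> linear_configuration e (rev R) ->
  exists d, [/\ [::] \notin R, links_fit (shape R) d
    & numbering e (rows_adj (shape R) d) (flatten R)].
Proof.
move=> /card_gt0P[x0 _] tree conf.
have [R_n0 perm_R sorted_R _] := (linear_configuration_rev e R).1 conf.
have uniq_R : uniq (flatten R) by rewrite (perm_uniq perm_R) enum_uniq.
have R_mem x : x \in flatten R by rewrite (perm_mem perm_R) mem_enum.
have linkP l : exists c, (l.+1 < size R) ==> linked e R x0 l c.
  have [l_R|_] := ltnP l.+1 (size R); last by exists 0.
  by have [c lc] := configuration_link_exists x0 tree conf l_R; exists c.
pose d l : nat := xchoose (linkP l).
have d_linked l : l.+1 < size R -> linked e R x0 l (d l).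
  exact/implyP/(xchooseP (linkP l)).
have fit : links_fit (shape R) d.
  by move=> l; rewrite size_map !nth_shape => /d_linked/andP[].
exists d; split=> //; split=> // x y.
have stepP z z' := rows_stepP x0 uniq_R fit (R_mem z) (R_mem z').
apply/idP/orP => [|step].
  case/(configuration_edge x0 tree conf)=> [[l l_R]|[l [c [l_R lc xy]]]].
    case/(path_edgeP x0)=> c c_l xy.
    by case: xy => [] [? ?]; [left | right]; apply/stepP; left; exists l, c.
  have {lc}cE : c = d l.
    exact: (configuration_link_uniq tree conf l_R lc (d_linked l l_R)).
  by case: xy => [] [? ?]; [left | right];
    apply/stepP; right; exists l; rewrite -cE.
have {}stepP z z' :
    rows_step (shape R) d (index z (flatten R)) (index z' (flatten R)) ->
    e z z'.
  case/stepP=> [[l [c [c_l -> ->]]]|[l [l_R -> ->]]]; last first.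
    by have /andP[] := d_linked l l_R.
  have l_R : l < size R.
    by rewrite ltnNge; apply: contraTN c_l => R_l; rewrite nth_default.
  exact: (sortedP x0 (sorted_R _ (mem_nth [::] l_R))).
by case: step => /stepP //; rewrite (tree_sym tree).
Qed.

Lemma numbering_configuration (T : finType) (e : rel T) D R d :
  tree_metric e D -> [::] \notin R -> links_fit (shape R) d ->
  numbering e (rows_adj (shape R) d) (flatten R) ->
  linear_configuration e (rev R).
Proof.
move=> tree R_n0 fit num; have uniq_R := numbering_uniq num.
have R_mem := numbering_mem num.
have stepP x0 x y := rows_stepP x0 uniq_R fit (R_mem x) (R_mem y).
have row_sorted l : l < size R -> sorted e (nth [::] R l).
  move=> l_R; case E : (nth [::] R l) => [|x0 P] //; rewrite -E.
  apply/(sortedP x0) => c c_l; rewrite num.2; apply/orP; left.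
  by apply/(stepP x0); left; exists l, c.
apply/linear_configuration_rev; split=> //; first exact: num.1.
  by move=> P /(nthP [::])[l l_R <-]; apply: row_sorted.
have link x y : ~~ has (fun P => path_edge P x y) R ->
    rows_step (shape R) d (index x (flatten R)) (index y (flatten R)) ->
    exists2 l, l.+1 < size R &
      link_edge e (nth [::] R l.+1) (nth [::] R l) y x.
  move=> no_row /(stepP x)[[l [c [c_l xE yE]]]|[l [l_R xE yE]]].
    case/negP: no_row; apply/hasP; exists (nth [::] R l).
      apply: mem_nth; rewrite ltnNge; apply: contraTN c_l => R_l.
      by rewrite nth_default.
    by apply/(path_edgeP x); exists c => //; left.
  exists l => //; have row_uniq k := uniq_flatten_row k uniq_R.
  apply/(link_edgeP _ _ tree (row_sorted _ l_R) (row_uniq _)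
           (row_sorted _ (ltnW l_R)) (row_uniq _)).
  have := fit l; rewrite size_map !nth_shape minnC => /(_ l_R) d_lt.
  have entry_lt : size (nth [::] R l.+1) - (d l).+1 < size (nth [::] R l.+1).
    by lia.
  by exists (d l); split=> //; rewrite {1}yE; apply: set_nth_default.
move=> x y; rewrite num.2 => /orP[] step no_row.
  by have [l l_R lxy] := link x y no_row step; exists l => //; right.
have [|l l_R lxy] := link y x _ step; last by exists l => //; left.
by rewrite (eq_has (fun P => path_edge_sym P y x)).
Qed.

(** * Rows of constant lengths on both sides of the bridge *)

Lemma muln_pred_add q k : 0 < q -> q * k = q.-1 * k + k.
Proof. by move=> q_gt0; rewrite -mulSnr prednK. Qed.

Lemma block_left_foot_lt q k d : 0 < q -> d < k -> q.-1 * k + d < q * k.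
Proof. by move=> q_gt0 d_k; rewrite (muln_pred_add k q_gt0) ltn_add2l. Qed.

Lemma block_left_foot_end q k d : 0 < q -> d < k ->
  q * k - 1 - (q.-1 * k + d) = k - d.+1.
Proof.
by move=> q_gt0 d_k; rewrite (muln_pred_add k q_gt0) subnAC subnDl; lia.
Qed.

Lemma block_right_foot_lt q k d : 0 < q -> d < k -> k - d.+1 < q * k.
Proof. by move=> q_gt0 d_k; have := leq_pmull k q_gt0; lia. Qed.

Definition block_numbering (T : finType) (e : rel T) q1 m q2 k1 d k2 L : Prop :=
  H_numbering e (q1 * k1) (m * d.+1) (q2 * k2) (q1.-1 * k1 + d) (k2 - d.+1) L.

Section BlockRows.
Variables q1 m q2 k1 d k2 : nat.

(* The row lengths before, along and after the bridge path. *)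
Definition block_shape := nseq q1 k1 ++ nseq m d.+1 ++ nseq q2 k2.

(* The distance d at which row l is linked to the next one, see row_exit. *)
Definition block_links l :=
  if l.+1 < q1 then k1.-1 else if l < q1 + m then d else k2.-1.

Lemma nth_block_shape l : nth 0 block_shape l =
  if l < q1 then k1 else if l < q1 + m then d.+1
  else if l < q1 + m + q2 then k2 else 0.
Proof. by rewrite !nth_cat !size_nseq !nth_nseq; do ?case: ifP => ?; lia. Qed.

Lemma size_block_shape : size block_shape = q1 + m + q2.
Proof. by rewrite !size_cat !size_nseq addnA. Qed.

Lemma sumn_block_shape : sumn block_shape = q1 * k1 + m * d.+1 + q2 * k2.
Proof. by rewrite !sumn_cat !sumn_nseq; lia. Qed.

Local Notation start l := (flatten_index block_shape l 0).

Lemma start_block_shape :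
  [/\ start q1.-1 = q1.-1 * k1, start q1 = q1 * k1
    & start (q1 + m) = q1 * k1 + m * d.+1].
Proof.
rewrite /flatten_index !addn0 /block_shape; split.
- rewrite takel_cat ?size_nseq ?leq_pred // take_nseq ?leq_pred //.
  by rewrite sumn_nseq mulnC.
- by rewrite take_size_cat ?size_nseq // sumn_nseq mulnC.
rewrite catA take_size_cat ?size_cat ?size_nseq //.
by rewrite sumn_cat !sumn_nseq mulnC (mulnC m).
Qed.

Hypotheses (q1_gt0 : 0 < q1) (q2_gt0 : 0 < q2) (d_gt0 : 0 < d).
Hypotheses (d_k1 : d < k1) (d_k2 : d < k2).

Lemma block_shape_gt0 : 0 \notin block_shape.
Proof. by rewrite !mem_cat !mem_nseq; lia. Qed.

Lemma block_links_fit : links_fit block_shape block_links.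
Proof.
move=> l; rewrite size_block_shape !nth_block_shape /block_links => l_lt.
by do ?case: ifP => ?; lia.
Qed.

Lemma block_links_exit l : l.+1 < q1 + m + q2 ->
  block_links l = if l.+1 == q1 then d else (nth 0 block_shape l).-1.
Proof.
move=> l_lt; rewrite nth_block_shape /block_links.
have [//|l_q1|<-] := ltngtP l.+1 q1; last by rewrite leq_addr.
by have [//|_|//] := ltngtP l.+1 (q1 + m); rewrite ifT //; lia.
Qed.

Lemma block_links_entry l : l.+1 < q1 + m + q2 ->
  block_links l = if l.+1 == q1 + m then d else (nth 0 block_shape l.+1).-1.
Proof.
move=> l_lt; rewrite nth_block_shape /block_links.
have [l_m|l_m|l_m] := ltngtP l.+1 (q1 + m).
- by case: ltngtP.
- by case: ifP => // _; rewrite l_lt.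
- by rewrite ifN //; lia.
Qed.

Lemma block_ends :
  row_exit block_shape block_links q1.-1 = q1.-1 * k1 + d /\
  row_entry block_shape block_links (q1 + m) =
    q1 * k1 + m * d.+1 + (k2 - d.+1).
Proof.
have [start_last _ start_m] := start_block_shape; split.
  by rewrite row_exitE start_last /block_links prednK // ltnn leq_addr.
rewrite row_entryE start_m nth_block_shape /block_links prednK; last lia.
by rewrite ltnNge leq_addr /= ltnn ifT ?leqnn //; lia.
Qed.

Lemma block_cutE links c :
  (forall l, l.+1 < q1 + m + q2 -> links l = block_links l) ->
  0 < c < sumn block_shape ->
  cut_lo (reshape_index block_shape) (row_exit block_shape links) c =
    (if c == start q1 then start q1.-1 + d else c.-1) /\
  cut_hi (reshape_index block_shape) (row_entry block_shape links) c =
    (if c == start (q1 + m) then start (q1 + m) + (k2 - d.+1) else c).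
Proof.
move=> linksE c_lt; have shape_size := size_block_shape.
have start_eq l l' := @row_start_eq _ block_shape_gt0 l l'.
have [[not_start -> ->]|[l [l_lt cE -> ->]]] :=
  rows_cutP links block_shape_gt0 c_lt.
  by rewrite !(negPf (not_start _ _)) ?shape_size //; lia.
rewrite shape_size in l_lt.
have startS : start l.+1 = start l + nth 0 block_shape l.
  by rewrite flatten_index_next ?shape_size 1?ltnW // /flatten_index addn0.
have c_q1 : (c == start q1) = (l.+1 == q1).
  by rewrite cE start_eq // shape_size; lia.
have c_m : (c == start (q1 + m)) = (l.+1 == q1 + m).
  by rewrite cE start_eq // shape_size; lia.
have k_gt0 : 0 < nth 0 block_shape l.
  by apply: row_length_gt0 block_shape_gt0 _ _; rewrite shape_size ltnW.
have kS_gt0 : 0 < nth 0 block_shape l.+1.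
  by apply: row_length_gt0 block_shape_gt0 _ _; rewrite shape_size.
rewrite c_q1 c_m cE row_exitE row_entryE /= linksE //; split.
  by rewrite block_links_exit //; case: eqP => [<-|_] //; lia.
rewrite block_links_entry //; case: eqP => [->|_]; last by lia.
by rewrite nth_block_shape ltnNge leq_addr /= ltnn ifT //; lia.
Qed.

Lemma block_adjE links p q :
  (forall l, l.+1 < q1 + m + q2 -> links l = block_links l) ->
  p < sumn block_shape -> q < sumn block_shape ->
  rows_adj block_shape links p q =
  H_adj (q1 * k1) (m * d.+1) (q1.-1 * k1 + d) (k2 - d.+1) p q.
Proof.
move=> linksE; have i_s := block_left_foot_lt q1_gt0 d_k1.
have j_t := block_right_foot_lt q2_gt0 d_k2.
apply: eq_chain_adj => [||c c_lt].
- apply: rows_layout block_shape_gt0 _ => l l_lt.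
  by rewrite linksE -?size_block_shape //; apply: block_links_fit.
- by rewrite sumn_block_shape; apply: H_layout.
have [-> ->] := block_cutE linksE c_lt; rewrite sumn_block_shape in c_lt.
have [-> -> ->] := start_block_shape.
by rewrite (H_cut_lo i_s j_t) // (H_cut_hi i_s j_t).
Qed.
End BlockRows.

Lemma eq_on_interval (A : Type) (f : nat -> A) a b :
  (forall x, a <= x < b -> f x.+1 = f x) ->
  forall x, a <= x <= b -> f x = f a.
Proof.
move=> f_succ; elim=> [|x IHx] x_ab; first by congr f; lia.
by have [->//|ax] := eqVneq a x.+1; rewrite f_succ; [apply: IHx|]; lia.
Qed.

Section RowShape.
Variables (sh : seq nat) (d : nat -> nat) (a b : nat).
Hypotheses (sh_gt0 : 0 \notin sh) (fit : links_fit sh d) (ab : a < b < size sh).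
Local Notation k l := (nth 0 sh l).
Hypothesis degree_le3 :
  forall l c, l < size sh -> c < k l -> row_degree sh d l c <= 3.
Hypothesis branch :
  forall l c, l < size sh -> c < k l -> row_degree sh d l c = 3 ->
  l = a /\ c = d a \/ l = b /\ c = k b - (d b.-1).+1.

Lemma exit_at_end l : l.+1 < size sh -> l != a -> k l = (d l).+1.
Proof.
move=> l_sh l_a; have d_l := fit l_sh; have d_lt : d l < k l by lia.
have deg3 := degree_le3 (ltnW l_sh) d_lt; have br := branch (ltnW l_sh) d_lt.
apply/eqP; rewrite eq_sym eqn_leq d_lt leqNgt; apply/negP=> d_lt'.
move: deg3 br; rewrite /row_degree eqxx l_sh d_lt' => deg3 br.
by have [|[la _]|[lb]] := br; [| | rewrite -lb]; lia.
Qed.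

Lemma entry_at_start l : l.+1 < size sh -> l.+1 != b -> k l.+1 = (d l).+1.
Proof.
move=> l_sh l_b; have d_l := fit l_sh.
have [c cE] : exists c, c = k l.+1 - (d l).+1 by exists (k l.+1 - (d l).+1).
have c_lt : c < k l.+1 by lia.
have deg3 := degree_le3 l_sh c_lt; have br := branch l_sh c_lt.
move: deg3 br; rewrite /row_degree /= => deg3 br.
suff : ~~ (0 < c) by lia.
by apply/negP=> c_gt0; have [|[la]|[lb _]] := br; [| rewrite -la |]; lia.
Qed.

Lemma rows_block_shape :
  [/\ sh = block_shape a.+1 (b - a.+1) (size sh - b) (k a) (d a) (k b),
      0 < d a, d a < k a, d a < k b
    & forall l, l.+1 < size sh ->
      d l = block_links a.+1 (b - a.+1) (k a) (d a) (k b) l].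
Proof.
have step l : l.+1 < size sh -> l != a -> l.+1 != b -> k l.+1 = k l.
  by move=> l_sh l_a l_b; rewrite entry_at_start // (exit_at_end l_sh).
have k_before l : l <= a -> k l = k a.
  move=> l_a; have const x : 0 <= x <= a -> k x = k 0.
    by apply: eq_on_interval => {}x x_a; apply: step; lia.
  by rewrite !const ?leqnn.
have k_between l : a < l < b -> k l = (d a).+1.
  move=> l_ab; rewrite (@eq_on_interval _ (nth 0 sh) a.+1 b.-1); last lia.
    by apply: entry_at_start; lia.
  by move=> x x_ab; apply: step; lia.
have k_after l : b <= l < size sh -> k l = k b.
  move=> l_b; apply: (@eq_on_interval _ (nth 0 sh) b (size sh).-1); last lia.
  by move=> x x_b; apply: step; lia.
have d_between l : a <= l < b -> d l = d a.
  move=> l_ab; have [->//|l_a] := eqVneq l a.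
  by apply/eqP; rewrite -eqSS -exit_at_end ?k_between //; lia.
have d_a : 0 < d a < minn (k a) (k a.+1) by apply: fit; lia.
have d_kb : d a < k b.
  rewrite -(@d_between b.-1); last lia.
  by have := fit (l := b.-1); rewrite prednK; lia.
split=> //; try lia.
  apply: (@eq_from_nth _ 0) => [|l l_sh].
    by rewrite size_block_shape; lia.
  rewrite nth_block_shape subnKC; last lia.
  case: ifP => [/k_before//|l_a].
  case: ifP => l_b; first by apply: k_between; lia.
  by rewrite ifT ?k_after //; lia.
move=> l l_sh; rewrite /block_links subnKC; last lia.
case: ifP => l_a; first by rewrite -(k_before l) ?exit_at_end //; lia.
case: ifP => l_b; first by apply: d_between; lia.
by rewrite -(k_after l) ?exit_at_end //; lia.
Qed.
End RowShape.

(** * Configurations with a bridge path *)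

Definition bridge_rows (T : finType) (e : rel T) (R : seq (seq T)) a b w w' :
    Prop :=
  [/\ a < b < size R, w != w' /\ [set x | degree e x == 3] = [set w; w'],
      w \in nth [::] R a /\ w' \in nth [::] R b,
      exists2 y, y \in nth [::] R a.+1 & e w y
    & exists2 y, y \in nth [::] R b.-1 & e w' y].

Lemma path_like_with_bridge_path_rev (T : finType) (e : rel T) :
  path_like_with_bridge_path e <->
  exists R a b w w', linear_configuration e (rev R) /\ bridge_rows e R a b w w'.
Proof.
split.
  case=> C [l [m [w1 [w2 [conf [[m_gt0 lm] [w12 D] [w1C w2C] x1 x2]]]]]].
  exists (rev C), (size C - (l + m).+1), (size C - l.+1), w2, w1.
  rewrite revK; split=> //; rewrite /bridge_rows size_rev.
  rewrite eq_sym setUC !nth_rev; try lia.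
  have -> : size C - (size C - (l + m).+1).+2 = l + m - 1 by lia.
  have -> : size C - (size C - l.+1).-1.+1 = l + 1 by lia.
  have -> : size C - (size C - (l + m).+1).+1 = l + m by lia.
  have -> : size C - (size C - l.+1).+1 = l by lia.
  by split=> //; lia.
case=> R [a [b [w [w' [conf [ab [ww' D] [wR w'R] x1 x2]]]]]].
exists (rev R), (size R - b.+1), (b - a), w', w; split=> //.
rewrite eq_sym setUC size_rev !nth_rev; try lia.
have -> : size R - (size R - b.+1 + 1).+1 = b.-1 by lia.
have -> : size R - (size R - b.+1 + (b - a) - 1).+1 = a.+1 by lia.
have -> : size R - (size R - b.+1).+1 = b by lia.
have -> : size R - (size R - b.+1 + (b - a)).+1 = a by lia.
by split=> //; lia.
Qed.

Section BridgeRows.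
Variables (T : finType) (e : rel T) (R : seq (seq T)) (d : nat -> nat).
Hypotheses (R_n0 : [::] \notin R) (fit : links_fit (shape R) d).
Hypothesis num : numbering e (rows_adj (shape R) d) (flatten R).

Lemma rows_link_pos l x y : l.+1 < size R ->
  x \in nth [::] R l -> y \in nth [::] R l.+1 -> e x y || e y x ->
  index x (flatten R) = row_exit (shape R) d l /\
  index y (flatten R) = row_entry (shape R) d l.+1.
Proof.
move=> l_R; have uniq_R := numbering_uniq num; have R_mem := numbering_mem num.
rewrite !(mem_flatten_row uniq_R) // 1?ltnW // => /eqP xl /eqP yl.
rewrite !num.2 => xy; rewrite -yl -xl.
apply: chain_adj_next; first by rewrite xl yl.
by case/orP: xy => //; rewrite /rows_adj /chain_adj orbC.
Qed.

Lemma rows_vertex l c : l < size R -> c < nth 0 (shape R) l ->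
  exists2 x, index x (flatten R) = flatten_index (shape R) l c
           & degree e x = row_degree (shape R) d l c.
Proof.
move=> l_R c_l; have pos_lt : flatten_index (shape R) l c < size (flatten R).
  by rewrite size_flatten flatten_indexP.
have [x xE] := numbering_vertex num pos_lt; exists x => //.
rewrite (numbering_degree num) xE size_flatten; apply: count_rows_adj => //.
  by rewrite notin_shape.
by rewrite size_map.
Qed.

Lemma bridge_rows_pos a b w w' : bridge_rows e R a b w w' ->
  index w (flatten R) = row_exit (shape R) d a /\
  index w' (flatten R) = row_entry (shape R) d b.
Proof.
case=> ab _ [wR w'R] [y yR wy] [y' y'R w'y']; have b1 : b.-1.+1 = b by lia.
have [a_R b_R] : a.+1 < size R /\ b.-1.+1 < size R by lia.
have [//|-> _] := rows_link_pos a_R wR yR; first by rewrite wy.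
have := rows_link_pos b_R y'R; rewrite b1 => /(_ w' w'R).
by rewrite w'y' orbT => /(_ isT)[_ ->].
Qed.

Lemma bridge_rows_branch a b w w' l c : bridge_rows e R a b w w' ->
  l < size R -> c < nth 0 (shape R) l -> row_degree (shape R) d l c = 3 ->
  l = a /\ c = d a \/ l = b /\ c = nth 0 (shape R) b - (d b.-1).+1.
Proof.
move=> br l_R c_l; have [w_pos w'_pos] := bridge_rows_pos br.
case: br => ab [_ branches] _ _ _.
have [x xE <-] := rows_vertex l_R c_l => deg_x.
have coord l' c' : c' < nth 0 (shape R) l' ->
    index x (flatten R) = flatten_index (shape R) l' c' -> l = l' /\ c = c'.
  move=> c'_l'; rewrite xE => posE.
  have := congr1 (reshape_index (shape R)) posE.
  have := congr1 (reshape_offset (shape R)) posE.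
  by rewrite !flatten_indexKl ?flatten_indexKr.
have fit_a := fit (l := a); have fit_b := fit (l := b.-1).
rewrite size_map prednK in fit_a fit_b; last lia.
have : x \in [set w; w'] by rewrite -branches inE deg_x.
by rewrite !inE => /orP[] /eqP xw; [left | right]; apply: coord;
  rewrite ?xw //; lia.
Qed.

Lemma bridge_rows_shape a b w w' :
  (forall x, degree e x <= 3) -> bridge_rows e R a b w w' ->
  exists q1 m q2 k1 dl k2, [&& 0 < q1, 0 < q2, 0 < dl, dl < k1 & dl < k2] /\
    block_numbering e q1 m q2 k1 dl k2 (flatten R).
Proof.
move=> deg3 br; have size_shape : size (shape R) = size R by rewrite size_map.
have ab : a < b < size R by case: br.
have [|||||shE dl_gt0 dl_k1 dl_k2 linksE] := @rows_block_shape (shape R) d a b.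
- by rewrite notin_shape.
- exact: fit.
- by rewrite size_shape.
- move=> l c; rewrite size_shape => l_R c_l.
  by have [x _ <-] := rows_vertex l_R c_l; apply: deg3.
- by move=> l c; rewrite size_shape; apply: bridge_rows_branch br.
move: (nth 0 (shape R) a) (nth 0 (shape R) b) shE dl_k1 dl_k2 linksE.
rewrite size_shape => k1 k2 shE dl_k1 dl_k2 linksE.
have sizeL : size (flatten R) = sumn (shape R) := size_flatten R.
exists a.+1, (b - a.+1), (size R - b), k1, (d a), k2; split; first by lia.
split; first by rewrite sizeL shE sumn_block_shape.
apply: (eq_numbering num) => p q; rewrite sizeL shE => pN qN.
by rewrite block_adjE // => [|l l_lt]; [|apply: linksE]; lia.
Qed.

Lemma rows_link_vertices l : symmetric e -> l.+1 < size R ->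
  exists x y, [/\ index x (flatten R) = row_exit (shape R) d l,
    index y (flatten R) = row_entry (shape R) d l.+1,
    x \in nth [::] R l, y \in nth [::] R l.+1 & e x y && e y x].
Proof.
move=> sym_e l_R; have uniq_R := numbering_uniq num.
have R_mem := numbering_mem num.
have := fit (l := l); rewrite size_map => /(_ l_R) d_l.
have d_lt : d l < nth 0 (shape R) l by lia.
have dS_lt : nth 0 (shape R) l.+1 - (d l).+1 < nth 0 (shape R) l.+1 by lia.
have [x xE _] := rows_vertex (ltnW l_R) d_lt.
have [y yE _] := rows_vertex l_R dS_lt.
exists x, y; rewrite !(mem_flatten_row uniq_R) // 1?ltnW //.
rewrite [e y x]sym_e andbb num.2.
rewrite xE yE !flatten_indexKl // !eqxx; split=> //.
by rewrite /rows_adj /chain_adj /chain_step !flatten_indexKl // !eqxx orbT.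
Qed.

Lemma bridge_rows_exist a b : symmetric e -> a < b < size R ->
  (forall x, degree e x = 3 <->
     index x (flatten R) = row_exit (shape R) d a \/
     index x (flatten R) = row_entry (shape R) d b) ->
  exists w w', bridge_rows e R a b w w'.
Proof.
move=> sym_e /andP[a_b b_R] branchP.
have aS_R : a.+1 < size R := leq_ltn_trans a_b b_R.
have b1 : b.-1.+1 = b by lia.
have b1_R : b.-1.+1 < size R by rewrite b1.
have [w [y [w_pos _ wR yR /andP[wy _]]]] := rows_link_vertices sym_e aS_R.
have [y' [w' [_ + y'R + /andP[_ w'y']]]] := rows_link_vertices sym_e b1_R.
rewrite b1 => w'_pos w'R; exists w, w'; split=> //; first by rewrite a_b.
- split.
    apply/eqP=> ww'; move: wR w'R; rewrite ww'.
    have [uniq_R R_mem] := (numbering_uniq num, numbering_mem num).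
    rewrite !(mem_flatten_row uniq_R) // ?(ltnW aS_R) //.
    by move=> /eqP -> /eqP; lia.
  apply/setP=> x; rewrite !inE; apply/eqP/orP => [/branchP|].
    rewrite -w_pos -w'_pos.
    by case=> /(numbering_index_inj num) ->; rewrite eqxx; [left | right].
  by case=> /eqP ->; apply/branchP; [left | right].
- by exists y.
- by exists y'.
Qed.
End BridgeRows.

Lemma bridge_path_numbering (T : finType) (e : rel T) D :
  tree_metric e D -> (forall x, degree e x <= 3) ->
  path_like_with_bridge_path e ->
  exists q1 m q2 k1 d k2 L, [&& 0 < q1, 0 < q2, 0 < d, d < k1 & d < k2] /\
    block_numbering e q1 m q2 k1 d k2 L.
Proof.
move=> tree deg3 /path_like_with_bridge_path_rev[R [a [b [w [w' [conf br]]]]]].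
have T_gt0 : 0 < #|T| by apply/card_gt0P; exists w.
have [links [R_n0 fit num]] := configuration_numbering T_gt0 tree conf.
have [q1 [m [q2 [k1 [d [k2 shape]]]]]] :=
  bridge_rows_shape R_n0 fit num deg3 br.
by exists q1, m, q2, k1, d, k2, (flatten R).
Qed.

Lemma block_bridge_path (T : finType) (e : rel T) q1 m q2 k1 d k2 L :
  0 < q1 -> 0 < q2 -> 0 < d -> d.+1 < k1 -> d.+1 < k2 ->
  block_numbering e q1 m q2 k1 d k2 L -> path_like_with_bridge_path e.
Proof.
move=> q1_gt0 q2_gt0 d_gt0 dS_k1 dS_k2 numL.
have [d_k1 d_k2] := (ltnW dS_k1, ltnW dS_k2).
have i_s := block_left_foot_lt q1_gt0 d_k1.
have j_t := block_right_foot_lt q2_gt0 d_k2.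
have i_int : 0 < q1.-1 * k1 + d < q1 * k1 - 1.
  by rewrite (muln_pred_add k1 q1_gt0); move: (q1.-1 * k1) => q1k1; lia.
have j_int : 0 < k2 - d.+1 < q2 * k2 - 1.
  by rewrite (muln_pred_add k2 q2_gt0); move: (q2.-1 * k2) => q2k2; lia.
have tree := H_numbering_tree i_s j_t numL.
pose sh := block_shape q1 m q2 k1 d k2; pose links := block_links q1 m k1 d k2.
have sizeL : size L = sumn sh by rewrite sumn_block_shape; exact: numL.1.
pose R := reshape sh L.
have shR : shape R = sh by rewrite reshapeKl // sizeL.
have flatR : flatten R = L by rewrite reshapeKr // sizeL.
have fit : links_fit (shape R) links by rewrite shR; apply: block_links_fit.
have R_n0 : [::] \notin R by rewrite -notin_shape shR block_shape_gt0 // ltnW.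
have num : numbering e (rows_adj (shape R) links) (flatten R).
  rewrite flatR shR; apply: (eq_numbering numL.2) => p q.
  by rewrite sizeL => pN qN; rewrite block_adjE.
have sizeR : size R = q1 + m + q2 by rewrite size_reshape size_block_shape.
have [exit_pos entry_pos] := block_ends m q1_gt0 q2_gt0 d_gt0 d_k1 d_k2.
apply/path_like_with_bridge_path_rev; exists R, q1.-1, (q1 + m).
have [||w [w' br]] := bridge_rows_exist (a := q1.-1) (b := q1 + m)
  R_n0 fit num (tree_sym tree).
- by rewrite sizeR; lia.
- move=> x; rewrite shR exit_pos entry_pos flatR.
  rewrite (H_numbering_branch i_s j_t numL) i_int j_int.
  by split=> [[[-> _]|[-> _]]|[->|->]]; [left | right | left | right].
by exists w, w'; split=> //; apply: numbering_configuration tree R_n0 fit num.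
Qed.

(** * The divisibility conditions *)

Definition arm_condition (s a delta : nat) : Prop :=
  exists2 d, d %| s & delta < d /\ (d - delta = a - 1 \/ d - delta = s - a).

Lemma arm_end_gt1 s a delta : 1 < a < s ->
  delta \in [:: a; s - a + 1] -> 1 < delta.
Proof. by rewrite !inE; lia. Qed.

Lemma arm_condition_end s a delta : 1 < a < s ->
  delta \in [:: a; s - a + 1] -> arm_condition s a delta.
Proof. by rewrite !inE => a_s delta_a; exists s => //; lia. Qed.

Lemma arm_condition_min s a delta d : 1 < a < s ->
  d %| s -> d - delta = minn (a - 1) (s - a) -> arm_condition s a delta.
Proof. by move=> a_s d_s dE; exists d => //; lia. Qed.

(* A proper divisor d of s is at most s / 2, so that d - delta is then the
   smaller of the two values. *)
Lemma arm_conditionP s a delta : 1 < a < s -> 1 < delta ->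
  arm_condition s a delta -> delta \in [:: a; s - a + 1] \/
  exists d, [/\ d %| s, delta < d & d - delta = minn (a - 1) (s - a)].
Proof.
move=> a_s delta_gt1 [d /[dup] d_s /dvdnP[q sE] [delta_d dE]]; rewrite !inE.
case: q sE => [|[|q]] sE; [lia | left; lia | right].
by exists d; split=> //; rewrite !mulSn in sE; lia.
Qed.

Lemma arm_shape_condition s a q k d i : 1 < a < s -> i < q * k ->
  arm_shape s (a - 1) = arm_shape (q * k) i ->
  k - d.+1 = i \/ k - d.+1 = q * k - 1 - i -> arm_condition s a d.+1.
Proof.
move=> a_s i_lt [sE maxE] kE.
by exists k; rewrite sE ?dvdn_mull // in maxE *; lia.
Qed.

Lemma bridge_path_arm_conditions (T : finType) (e : rel T) (s t r a b : nat) :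
  0 < r -> 1 < a < s -> 1 < b < t -> is_type_H e s t r a b ->
  path_like_with_bridge_path e ->
  exists delta, [/\ 1 < delta, arm_condition s a delta,
    arm_condition t b delta & delta %| r - 1].
Proof.
move=> r_gt0 a_s b_t hT bridge.
have [L num] : exists L, H_numbering e s (r - 1) t (a - 1) (b - 1) L.
  by apply: type_H_numbering hT _ _ => //; lia.
have [i_s j_t] : a - 1 < s /\ b - 1 < t by lia.
have [q1 [m [q2 [k1 [d [k2 [L' []]]]]]]] := bridge_path_numbering
  (H_numbering_tree i_s j_t num) (H_numbering_degree_le3 i_s j_t num) bridge.
case/and5P=> q1_gt0 q2_gt0 d_gt0 d_k1 d_k2 num'.
have i_lt := block_left_foot_lt q1_gt0 d_k1.
have j_lt := block_right_foot_lt q2_gt0 d_k2.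
have [||gE arms] := H_numbering_params _ _ i_lt j_lt num num'; try lia.
have left_arm s' a' : 1 < a' < s' ->
    arm_shape s' (a' - 1) = arm_shape (q1 * k1) (q1.-1 * k1 + d) ->
    arm_condition s' a' d.+1.
  move=> a'_s' /arm_shape_condition; apply=> //; right.
  by rewrite block_left_foot_end.
have right_arm s' a' : 1 < a' < s' ->
    arm_shape s' (a' - 1) = arm_shape (q2 * k2) (k2 - d.+1) ->
    arm_condition s' a' d.+1.
  by move=> a'_s' /arm_shape_condition; apply=> //; left.
exists d.+1; rewrite gE dvdn_mull //; split=> //.
- by case: arms => [] [? ?]; [apply: left_arm | apply: right_arm].
- by case: arms => [] [? ?]; [apply: right_arm | apply: left_arm].
Qed.

Lemma arm_conditions_bridge_path (T : finType) (e : rel T)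
    (s t r a b delta : nat) :
  0 < r -> 1 < a < s -> 1 < b < t -> is_type_H e s t r a b ->
  1 < delta -> arm_condition s a delta -> arm_condition t b delta ->
  delta %| r - 1 -> path_like_with_bridge_path e.
Proof.
move=> r_gt0 a_s b_t hT delta_gt1.
case=> k1 /dvdnP[q1 sE] [delta_k1 k1E] [k2 /dvdnP[q2 tE] [delta_k2 k2E]].
case/dvdnP=> m gE.
have q1_gt0 : 0 < q1 by case: q1 sE; lia.
have q2_gt0 : 0 < q2 by case: q2 tE; lia.
have [L numL] : exists L,
    H_numbering e s (r - 1) t (s - 1 - (k1 - delta)) (k2 - delta) L.
  by apply: type_H_numbering hT _ _ => //; lia.
have deltaS : delta.-1.+1 = delta by lia.
apply: (@block_bridge_path _ _ q1 m q2 k1 delta.-1 k2 L); try lia.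
rewrite /block_numbering deltaS -sE -tE -gE.
have <- // : s - 1 - (k1 - delta) = q1.-1 * k1 + delta.-1.
have d_k1 : delta.-1 < k1 by lia.
have i_s := block_left_foot_lt q1_gt0 d_k1.
by rewrite sE -{1}deltaS -(block_left_foot_end q1_gt0 d_k1) subKn //; lia.
Qed.

Theorem theorem3 (T : finType) (e : rel T) (s t r a b : nat)
  (hr : 1 <= r) (ha : 1 < a < s) (hb : 1 < b < t)
  (hT : is_type_H e s t r a b) :
  path_like_with_bridge_path e <->
  [\/ (exists d1 d2 delta : nat,
         [/\ d1 %| s /\ d2 %| t,
             2 <= delta <= minn d1 d2 - 1,
             d1 - delta = minn (a - 1) (s - a),
             d2 - delta = minn (b - 1) (t - b)
           & delta %| r - 1]),
      (exists delta : nat,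
         [/\ delta \in [:: a; s - a + 1],
             delta \in [:: b; t - b + 1]
           & delta %| r - 1]),
      (exists delta d2 : nat,
         [/\ delta \in [:: a; s - a + 1],
             d2 %| t,
             d2 - delta = minn (b - 1) (t - b)
           & delta %| r - 1])
    | (exists delta d1 : nat,
         [/\ delta \in [:: b; t - b + 1],
             d1 %| s,
             d1 - delta = minn (a - 1) (s - a)
           & delta %| r - 1])].
Proof.
split.
  case/(bridge_path_arm_conditions hr ha hb hT) => delta [delta_gt1].
  move=> /(arm_conditionP ha delta_gt1) arm_s.
  move=> /(arm_conditionP hb delta_gt1) arm_t delta_r.
  case: arm_s => [delta_a|[d1 [d1_s delta_d1 d1E]]];
    case: arm_t => [delta_b|[d2 [d2_t delta_d2 d2E]]].
  - by constructor 2; exists delta.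
  - by constructor 3; exists delta, d2.
  - by constructor 4; exists delta, d1.
  - by constructor 1; exists d1, d2, delta; split=> //; lia.
have bridge delta := arm_conditions_bridge_path hr ha hb hT (delta := delta).
case=> [[d1 [d2 [delta [[d1_s d2_t] /andP[delta_gt1 _] d1E d2E]]]]
       |[delta [delta_a delta_b]]|[delta [d2 [delta_a d2_t d2E]]]
       |[delta [d1 [delta_b d1_s d1E]]]]; apply: bridge => //.
- exact: arm_condition_min d1_s d1E.
- exact: arm_condition_min d2_t d2E.
- exact: arm_end_gt1 delta_a.
- exact: arm_condition_end.
- exact: arm_condition_end.
- exact: arm_end_gt1 delta_a.
- exact: arm_condition_end.
- exact: arm_condition_min d2_t d2E.
- exact: arm_end_gt1 delta_b.
- exact: arm_condition_min d1_s d1E.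
- exact: arm_condition_end.
Qed.
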